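(* Let $\Omega\subset\mathbb R^n$ be open. If $u\in L^1_{\mathrm{loc}}(\Omega;V)$ is everywhere approximately Lebesgue continuous and $\mathcal Au\in\mathcal M(\Omega;W)$, then $|\mathcal Au|$ vanishes on Borel sets that are $\sigma$-finite with respect to $\mathcal H^{n-1}$, i.e., $$U\subset\Omega\text{ Borel with }\mathcal H^{n-1}(U)<\infty\quad\Longrightarrow\quad|\mathcal Au|(U)=0.$$ In particular, $|\mathcal Au|(M)=0$ for all $C^1$-hypersurfaces $M\subset\Omega$.
   Context: $V,W$ are finite-dimensional inner product spaces, $A_1,\dots,A_n\in\mathrm{Hom}(V,W)$, and $\mathcal A=\sum_{i=1}^nA_i\partial_i$ acts on $V$-valued distributions with values in $W$-valued distributions. $\mathcal M(\Omega;W)$ is the space of locally bounded $W$-valued Borel measures on $\Omega$; $|\mu|$ is the total variation measure; $\mathcal H^{n-1}$ is the $(n-1)$-dimensional Hausdorff measure. $u$ is approximately Lebesgue continuous at $x\in\Omega$ if there is $z\in V$ with $\limsup_{r\to0}\frac{1}{|B_r(x)|}\int_{B_r(x)}|u(y)-z|\,dy=0$; ''everywhere'' means at every $x\in\Omega$. *)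

(* Defs.v *)
From HB Require Import structures.
From mathcomp Require Import all_boot all_order all_algebra.
From mathcomp Require Import all_classical all_reals all_analysis.
From mathcomp Require Import measurable_realfun.

Set Implicit Arguments.
Unset Strict Implicit.
Unset Printing Implicit Defensive.
Import Order.TTheory GRing.Theory Num.Theory.
Import numFieldNormedType.Exports.
Local Open Scope classical_set_scope.
Local Open Scope ring_scope.

(* Matrices, in particular the row vectors 'rV[R]_n modelling R^n, carry their
   Borel sigma-algebra, so [measurable] means Borel for subsets of 'rV[R]_n. *)
Section borel_matrix.
Context {R : realType} {m n : nat}.
Let G : set (set 'M[R]_(m, n)) := open.

HB.instance Definition _ := @isMeasurable.Build (sigma_display G)
  'M[R]_(m, n) <<s G >> (@sigma_algebra0 _ setT G) (@sigma_algebraC _ G)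
  (@sigma_algebra_bigcup _ setT G).

Lemma open_measurable_mx (A : set 'M[R]_(m, n)) : open A -> measurable A.
Proof. exact: sub_sigma_algebra. Qed.

End borel_matrix.

Section lebesgue_measure_rV.
Context {R : realType}.

Definition consrV n (p : measurableTypeR R * 'rV[R]_n) : 'rV[R]_n.+1 :=
  row_mx ((p.1 : R)%:M : 'rV[R]_1) p.2.

Lemma ball_consrV n (p q : measurableTypeR R * 'rV[R]_n) (e : R) :
  ball (p.1 : R) e (q.1 : R) -> ball p.2 e q.2 ->
  ball (consrV p) e (consrV q).
Proof.
move=> h1 h2; split; first by case: h2.
move=> i j; rewrite /consrV !mxE (ord1 i).
case: splitP => k _ ; last by case: h2 => _; apply.
by rewrite !mxE !(ord1 k) !eqxx !mulr1n.
Qed.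

Lemma rat_near (x e : R) : 0 < e -> exists q : rat, ball x e (ratr q).
Proof.
move=> e0; have xe0 : ball x e !=set0 by exists x; exact: ballxx.
have [y [xy [q _ qy]]] := dense_rat xe0 (@ball_open R R^o x e).
by exists q; rewrite qy.
Qed.

Lemma consrV0 n p : @consrV n p ord0 ord0 = p.1.
Proof.
by rewrite mxE; case: splitP => // j _; rewrite mxE !ord1 eqxx mulr1n.
Qed.

Lemma consrVS n p i : @consrV n p ord0 (lift ord0 i) = p.2 ord0 i.
Proof.
rewrite mxE; case: splitP => [j|k] /=; first by rewrite ord1.
by move=> [ik]; congr (p.2 _ _); exact: val_inj.
Qed.

Lemma measurable_consrV n : measurable_fun setT (@consrV n).
Proof.
apply: (@measurability _ _ _ _ _ _ (@open 'M[R]_(1, n.+1)) erefl).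
move=> _ [A oA <-]; rewrite setTI.
pose B (i : rat * 'rV[rat]_n * nat) : set (measurableTypeR R * 'rV[R]_n) :=
  ball (ratr i.1.1 : R) i.2.+1%:R^-1 `*`
  ball (map_mx ratr i.1.2 : 'rV[R]_n) i.2.+1%:R^-1.
pose C i := if `[< B i `<=` @consrV n @^-1` A >] then B i else set0.
rewrite (_ : _ @^-1` _ = \bigcup_i C i); last first.
  apply/seteqP; split => [[x v] Axv|p [i _]]; last first.
    by rewrite /C; case: asboolP => // + Bp; exact.
  have /nbhs_ballP[e /= e0 eA] : nbhs (consrV (x, v)) A.
    by apply: open_nbhs_nbhs.
  have [k ke] : exists k : nat, k.+1%:R^-1 < e / 2.
    have e20 : 0 < e / 2 by rewrite divr_gt0.
    have [k _ kP] := near_infty_natSinv_lt (PosNum e20).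
    by exists k; apply: (kP k) => /=.
  have k0 : 0 < k.+1%:R^-1 :> R by rewrite invr_gt0.
  have [q qx] := rat_near x k0.
  have /fin_all_exists[w wv] : forall j : 'I_n, exists q : rat,
      ball (v ord0 j) k.+1%:R^-1 (ratr q : R) by move=> j; exact: rat_near.
  have Bxv : B (q, \row_j w j, k) (x, v).
    split => /=; first exact: ball_sym.
    by split => // i j; rewrite !mxE (ord1 i); exact: ball_sym.
  exists (q, \row_j w j, k) => //; rewrite /C asboolT//.
  case=> y u [/= yq [_ uw]]; apply: eA; apply: ball_consrV => /=.
    apply: le_ball (ball_triangle qx yq).
    by rewrite (splitr e) lerD// ltW.
  case: Bxv => _ [_ /= vw]; split => // i j.
  apply: le_ball (ball_triangle (ball_sym (vw i j)) (uw i j)).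
  by rewrite (splitr e) lerD// ltW.
apply: countable_bigcupT_measurable => // i; rewrite /C.
case: ifP => // _; apply: measurableX; first exact: measurable_ball.
by apply: open_measurable_mx; exact: ball_open.
Qed.

Definition unconsrV n (v : 'rV[R]_n.+1) : measurableTypeR R * 'rV[R]_n :=
  (v ord0 ord0, @rsubmx R 1 1 n v).

Lemma consrVK n : cancel (@consrV n) (@unconsrV n).
Proof.
move=> [x v]; rewrite /unconsrV /consrV row_mxKr/=; congr pair.
by have := consrV0 (x, v); rewrite /consrV.
Qed.

Lemma continuous_measurable_rV_fun n d (T : measurableType d)
    (G : set (set T)) (f : 'rV[R]_n -> T) :
  @measurable _ T = <<s G >> -> (forall A, G A -> open (f @^-1` A)) ->
  measurable_fun setT f.
Proof.
move=> mG fG; apply: (measurability G mG) => _ [A GA <-].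
by rewrite setTI; apply: open_measurable_mx; exact: fG.
Qed.

Lemma measurable_unconsrV n : measurable_fun setT (@unconsrV n).
Proof.
apply/measurable_fun_pairP; split.
- apply: (@continuous_measurable_rV_fun n.+1 _ (measurableTypeR R)
    (@RGenOpens.G R) (fst \o @unconsrV n)).
    exact: RGenOpens.measurableE.
  move=> _ [a [b ->]]; rewrite (_ : _ @^-1` _ =
      (fun v : 'rV[R]_n.+1 => v ord0 ord0) @^-1` `]a, b[%classic)//.
  apply: open_comp; last exact: interval_open.
  by move=> v _; exact: coord_continuous.
- apply: (@continuous_measurable_rV_fun n.+1 _ 'rV[R]_n (@open 'rV[R]_n)
    (snd \o @unconsrV n)) => //.
  move=> A oA; rewrite (_ : _ @^-1` _ = @rsubmx R 1 1 n @^-1` A)//.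
  by apply: open_comp => // v _; exact: continuous_rsubmx.
Qed.

Section pushforward_consrV.
Variables (n : nat) (mu : {sigma_finite_measure set 'rV[R]_n -> \bar R}).

Definition lebesgue_prodrV : set 'rV[R]_n.+1 -> \bar R :=
  pushforward (lebesgue_measure \x mu)%E (@consrV n).

Let lebesgue_prodrV0 : lebesgue_prodrV set0 = 0%E.
Proof. by rewrite /lebesgue_prodrV /pushforward preimage_set0 measure0. Qed.

Let lebesgue_prodrV_ge0 A : (0 <= lebesgue_prodrV A)%E.
Proof. rewrite /lebesgue_prodrV /pushforward; exact: measure_ge0. Qed.

Let lebesgue_prodrV_sigma_additive : semi_sigma_additive lebesgue_prodrV.
Proof.
move=> F mF tF mUF.
rewrite /lebesgue_prodrV /pushforward preimage_bigcup.
have mpre A : measurable A -> measurable (@consrV n @^-1` A).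
  by move=> mA; rewrite -[X in measurable X]setTI; exact: measurable_consrV.
apply: measure_semi_sigma_additive.
- by move=> k; exact: mpre.
- apply/trivIsetP => /= i j _ _ ij; rewrite -preimage_setI.
  by move/trivIsetP : tF => /(_ _ _ _ _ ij) ->//; rewrite preimage_set0.
- by rewrite -preimage_bigcup; exact: mpre.
Qed.

HB.instance Definition _ := isMeasure.Build _ _ _ lebesgue_prodrV
  lebesgue_prodrV0 lebesgue_prodrV_ge0 lebesgue_prodrV_sigma_additive.

Let lebesgue_prodrV_sigma_finite : sigma_finite setT lebesgue_prodrV.
Proof.
have /sigma_finiteP[F [TF ndF Foo]] := sigma_finiteT (@lebesgue_measure R).
have /sigma_finiteP[G [TG ndG Goo]] := sigma_finiteT mu.
exists (fun k => @unconsrV n @^-1` (F k `*` G k)).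
  rewrite -preimage_bigcup (_ : \bigcup_k _ = setT) ?preimage_setT//.
  rewrite -setXTT TF TG predeqE => -[x y]; split.
    by move=> [k _ [/= Fkx Gky]]; split; exists k.
  move=> [/= [k _ Fkx] [j _ Gjy]]; exists (maxn k j) => //; split.
  - by move: x Fkx; exact/subsetPset/ndF/leq_maxl.
  - by move: y Gjy; exact/subsetPset/ndG/leq_maxr.
move=> k; have [mF Fk] := Foo k; have [mG Gk] := Goo k; split.
  rewrite -[X in measurable X]setTI; apply: measurable_unconsrV => //.
  exact: measurableX.
rewrite /lebesgue_prodrV /pushforward -comp_preimage.
rewrite (_ : _ \o _ = id); last by apply/funext => p; exact: consrVK.
by rewrite preimage_id product_measure1E// lte_mul_pinfty// ge0_fin_numE.
Qed.

HB.instance Definition _ := Measure_isSigmaFinite.Build _ _ _ lebesgue_prodrV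
  lebesgue_prodrV_sigma_finite.

End pushforward_consrV.

(* Lebesgue measure on R^n as an iterated product measure *)
Fixpoint lebesgue_rV n : {sigma_finite_measure set 'rV[R]_n -> \bar R} :=
  if n is m.+1 then @lebesgue_prodrV m (lebesgue_rV m) else \d_(0 : 'rV[R]_0).

Lemma lebesgue_rV_box n (A : 'I_n -> set R) : (forall i, measurable (A i)) ->
  lebesgue_rV n [set v | forall i, A i (v ord0 i)] =
  (\prod_(i < n) lebesgue_measure (A i))%E.
Proof.
elim: n A => [|n IH] A mA.
  by rewrite big_ord0/= diracE mem_set// => -[].
pose B : set 'rV[R]_n := [set v | forall i : 'I_n, A (lift ord0 i) (v ord0 i)].
have mB : measurable B.
  rewrite (_ : B = \bigcap_(i in [set: 'I_n])
      (fun v : 'rV[R]_n => v ord0 i) @^-1` A (lift ord0 i)); last first.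
    by apply/seteqP; split => v /= Bv i; [move=> _|]; exact: Bv.
  apply: fin_bigcap_measurable => // i _; rewrite -[X in measurable X]setTI.
  have : measurable_fun setT (fun v : 'rV[R]_n => v ord0 i : measurableTypeR R).
    apply: (@continuous_measurable_rV_fun n _ (measurableTypeR R)
      (@RGenOpens.G R)); first exact: RGenOpens.measurableE.
    move=> _ [a [b ->]]; apply: open_comp; last exact: interval_open.
    by move=> v _; exact: coord_continuous.
  by apply => //; exact: mA.
rewrite big_ord_recl -(IH (fun i => A (lift ord0 i)))//= -/B.
rewrite /lebesgue_prodrV /pushforward -product_measure1E//; last exact: mA.
congr (product_measure1 _ _ _); apply/seteqP; split => [[x v]|[x v] []] /=.
  move=> h; split => [|i]; first by have := h ord0; rewrite consrV0.
  by have := h (lift ord0 i); rewrite consrVS.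
move=> h1 h2 i; case: (unliftP ord0 i) => [j ->|->]; rewrite ?consrV0//.
by rewrite consrVS; exact: h2.
Qed.

End lebesgue_measure_rV.

Section euclidean_geometry.
Context {R : realType}.
Local Open Scope ereal_scope.

(* The norm and the balls of the library on 'rV[R]_n are those of the
   sup norm; Euclidean ones are needed here. *)
Definition enorm n (x : 'rV[R]_n) : R := Num.sqrt (\sum_i x ord0 i ^+ 2).

Definition eball n (x : 'rV[R]_n) (r : R) : set 'rV[R]_n :=
  [set y | (enorm (y - x) < r)%R].

Definition ediam n (E : set 'rV[R]_n) : \bar R :=
  ereal_sup [set (enorm (p.1 - p.2))%:E | p in E `*` E].

(* omega_k (diam E / 2)^k, where omega_k is the volume of the unit ball of R^k;
   by convention the empty set has weight 0 and 0^0 = 1, so that the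
   0-dimensional Hausdorff measure is the counting measure. *)
Definition hausdorff_weight n (k : nat) (E : set 'rV[R]_n) : \bar R :=
  if `[< E = set0 >] then 0
  else lebesgue_rV k (eball (0 : 'rV[R]_k) 1) * ((2^-1)%:E * ediam E) ^+ k.

Definition hausdorff_pre n (k : nat) (delta : R) (A : set 'rV[R]_n) : \bar R :=
  ereal_inf [set \sum_(j <oo) hausdorff_weight k (F j) |
    F in [set F : (set 'rV[R]_n)^nat |
      A `<=` \bigcup_j F j /\ forall j, ediam (F j) <= delta%:E]].

Definition hausdorff n (k : nat) (A : set 'rV[R]_n) : \bar R :=
  ereal_sup [set hausdorff_pre k delta A | delta in [set d : R | (0 < d)%R]].

End euclidean_geometry.

Section differentiability_classes.
Context {R : realType} {n : nat}.

(* f is of class C^k on the open set O: its iterated partial derivatives up to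
   order k exist and are continuous on O. *)
Fixpoint Ck (k : nat) (O : set 'rV[R]_n) (f : 'rV[R]_n -> R) : Prop :=
  (forall x, O x -> {for x, continuous f}) /\
  if k is k'.+1 then
    forall i, (forall x, O x -> derivable f x 'e_i) /\ Ck k' O ('D_'e_i f)
  else True.

Definition C1_hypersurface (M : set 'rV[R]_n) :=
  forall x, M x -> exists (O : set 'rV[R]_n) (g : 'rV[R]_n -> R),
    [/\ open O, O x, Ck 1 O g,
        (forall y, O y -> exists i, 'D_'e_i g y != 0) &
        M `&` O = [set y | O y /\ g y = 0]].

(* C_c^oo(O) *)
Definition test_function (O : set 'rV[R]_n) (phi : 'rV[R]_n -> R) :=
  (forall k, Ck k setT phi) /\
  exists K, [/\ compact K, K `<=` O & forall x, ~ K x -> phi x = 0].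

End differentiability_classes.

Section inner_product_valued.
Context {R : realType} {n : nat} {V : vectType R} (dot : {dot V for idfun}).
Local Open Scope ereal_scope.
Implicit Types (O : set 'rV[R]_n) (u : 'rV[R]_n -> V) (mu : set 'rV[R]_n -> V).

Definition dnorm (v : V) : R := Num.sqrt (dot v v).

(* V is finite-dimensional: u is measurable iff all its components are. *)
Definition L1loc O u :=
  (forall v, measurable_fun O (fun x => dot (u x) v)) /\
  forall K, compact K -> K `<=` O ->
    \int[lebesgue_rV n]_(x in K) (dnorm (u x))%:E < +oo.

Definition approx_Lebesgue_continuous u (x : 'rV[R]_n) :=
  exists z : V, limf_esup (fun r : R => (lebesgue_rV n (eball x r))^-1 *
    \int[lebesgue_rV n]_(y in eball x r) (dnorm (u y - z))%:E) 0%R^'+ = 0.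

(* Borel sets that are relatively compact in O: the domain of the locally
   bounded measures on O. *)
Definition rel_compact O (B : set 'rV[R]_n) :=
  measurable B /\ exists K, [/\ compact K, K `<=` O & B `<=` K].

(* M(O; V): V-valued set functions, countably additive on the Borel sets that
   are relatively compact in O; other values of mu are irrelevant. *)
Definition local_measure O mu :=
  forall F : (set 'rV[R]_n)^nat, (forall j, rel_compact O (F j)) ->
    trivIset setT F -> rel_compact O (\bigcup_j F j) ->
  (fun N => dnorm (\sum_(j < N) mu (F j) - mu (\bigcup_j F j))) @ \oo --> 0%R.

(* |mu|(B), for B a Borel subset of O, as a supremum over the countable
   partitions of B into pieces on which mu is defined. *)
Definition variation_measure O mu (B : set 'rV[R]_n) : \bar R :=
  ereal_sup [set \sum_(j <oo) (dnorm (mu (F j)))%:E |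
    F in [set F : (set 'rV[R]_n)^nat |
      [/\ forall j, rel_compact O (F j), trivIset setT F &
          \bigcup_j F j = B]]].

(* Positive variation of the scalar local measure lam, i.e. the positive part
   lam^+ of its Jordan decomposition; lam^- is the one of -lam. *)
Definition positive_variation O (lam : set 'rV[R]_n -> R)
    (B : set 'rV[R]_n) : \bar R :=
  ereal_sup [set (lam E)%:E | E in [set E | rel_compact O E /\ E `<=` B]].

(* The component along w of the integral of phi against mu. *)
Definition integral_local_measure O mu (phi : 'rV[R]_n -> R) (w : V) : \bar R :=
  \int[positive_variation O (fun E => dot (mu E) w)]_(x in O) (phi x)%:E -
  \int[positive_variation O (fun E => (- dot (mu E) w)%R)]_(x in O) (phi x)%:E.

End inner_product_valued.

(* The W-valued distribution sum_i A_i d_i u on O,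
     phi |-> - sum_i int_O (d_i phi) A_i u dx,
   is (the one induced by) the local measure mu. *)
Definition distribution_is_measure {R : realType} {n : nat} {V W : vectType R}
    (dotW : {dot W for idfun}) (A : 'I_n -> 'Hom(V, W)) (O : set 'rV[R]_n)
    (u : 'rV[R]_n -> V) (mu : set 'rV[R]_n -> W) :=
  forall phi, test_function O phi -> forall w : W,
  (integral_local_measure dotW O mu phi w =
   - \sum_i \int[lebesgue_rV n]_(x in O) ('D_'e_i phi x * dotW (A i (u x)) w)%:E)%E.

(* Main.v *)
From HB Require Import structures.
Require Import Defs.
From mathcomp Require Import all_boot all_order all_algebra.
From mathcomp Require Import all_classical all_reals all_analysis.
From mathcomp Require Import measurable_realfun lra ring.

(** Fix w in W. The scalar measure lam = (Au, w) is the divergence of the field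
    with components f_i = (A_i u, w), and f inherits from u the property that
    every point x has a vector c with the mean of |f - c| over B_r(x) tending
    to 0. It is enough to show lam E = 0 for the relatively compact Borel sets
    E which have, at every scale, covers by balls with radii satisfying
    sum r^(n-1) <= B ([slm_null]): with w = Au E this gives Au E = 0.

    Let K be a compact set, c one constant, and suppose that the integral of
    |f - c| over B_r(x) is at most eps r^n for all x in K and all small r.
    Cover K by balls B_p centred on K, of radii r_p, and test the divergence
    with the smooth cut-off phi = 1 - prod (1 - phi_p), for which |D phi| is
    at most the sum of the C / r_p on the dilated balls. The integral of D_i phi
    is 0 ([integral_partial_eq0]), so the constant c can be subtracted from f
    for free, and the integral of D phi . (f - c) is at most
    C' eps (sum r_p^(n-1)). As phi tends to the indicator of K when the balls
    shrink, |lam K| <= C' eps (sum r_p^(n-1)) ([divergence_compact_le]).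

    For fixed eps, every point of E belongs to one of countably many closed
    sets on which such an estimate holds with a fixed rational c and a fixed
    scale. Inner regularity replaces E, up to a small mass, by finitely many
    disjoint compact pieces, each with its own constant and scale. These have
    positive distance, so in a fine cover of their union no ball meets two
    of them: the estimates for the pieces add up, and |lam E| <= C'' eps B.
    Now let eps tend to 0.

    Sets of finite Hausdorff measure of dimension n - 1 have the required
    covers ([hausdorff_small_covers]). So do small pieces of a C^1 hypersurface,
    which are Lipschitz graphs by the mean value theorem
    ([C1_hypersurface_local_covers]). Countable unions are dealt with by
    countable additivity.

    Except in the translation of the hypotheses, balls are those of the sup
    norm, that is, cubes. *)

Set Implicit Arguments.
Unset Strict Implicit.
Unset Printing Implicit Defensive.
Import Order.TTheory GRing.Theory Num.Theory.
Import numFieldNormedType.Exports.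
Local Open Scope classical_set_scope.
Local Open Scope ring_scope.

(** * Smooth functions and cut-offs *)

Section smooth_functions.
Context {R : realType} {n : nat}.
Implicit Types f g : 'rV[R]_n -> R.

Lemma CkW k (O : set 'rV[R]_n) f : Ck k.+1 O f -> Ck k O f.
Proof.
elim: k f => [|k IH] f [cf df]; first by split.
by split => // i; have [di Di] := df i; split => //; exact: IH.
Qed.

Lemma Ck_cst k (c : R) : Ck k [set: 'rV[R]_n] (cst c).
Proof.
elim: k c => [|k IH] c; split => //; try by move=> x _; exact: cst_continuous.
move=> i; split; first by move=> x _; exact: derivable_cst.
rewrite (_ : 'D_'e_i (cst c) = cst 0) //.
by apply/funext => x; exact: derive_cst.
Qed.

Lemma CkD k f g : Ck k setT f -> Ck k setT g -> Ck k setT (f + g).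
Proof.
elim: k f g => [|k IH] f g [cf df] [cg dg]; split => //;
  try by move=> x _; apply: (@continuousD _ _ _ f g x); [exact: cf|exact: cg].
move=> i; have [fi Dfi] := df i; have [gi Dgi] := dg i; split.
  by move=> x _; apply: derivableD; [exact: fi|exact: gi].
rewrite (_ : 'D_'e_i (f + g) = 'D_'e_i f + 'D_'e_i g); first exact: IH.
by apply/funext => x; apply: deriveD; [exact: fi|exact: gi].
Qed.

Lemma CkM k f g : Ck k setT f -> Ck k setT g -> Ck k setT (f * g).
Proof.
elim: k f g => [|k IH] f g Cf Cg; have [cf df] := Cf; have [cg dg] := Cg;
  split => //; try by move=> x _; apply: (@continuousM _ _ f g x); [exact: cf|exact: cg].
move=> i; have [fi Dfi] := df i; have [gi Dgi] := dg i; split.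
  by move=> x _; apply: derivableM; [exact: fi|exact: gi].
rewrite (_ : 'D_'e_i (f * g) = f * 'D_'e_i g + g * 'D_'e_i f); last first.
  by apply/funext => x; apply: deriveM; [exact: fi|exact: gi].
by apply: CkD; apply: IH => //; exact: CkW.
Qed.

(** A directional derivative is the derivative at 0 of a function of one
    variable, so the one-variable chain rule applies. *)
Lemma derive_comp1 f (h : R -> R) (x v : 'rV[R]_n) :
  derivable f x v -> derivable h (f x) 1 ->
  derivable (h \o f) x v /\ 'D_v (h \o f) x = derive1 h (f x) * 'D_v f x.
Proof.
move=> df dh.
pose F (t : R) := f (t *: v + x).
have dF : derivable F 0 1 := (derivable1P f x v).1 df.
have dh' : derivable h (F 0) 1 by rewrite /F scale0r add0r.
have DE (q : 'rV[R]_n -> R) : 'D_v q x = derive1 (fun t : R => q (t *: v + x)) 0.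
  rewrite /derive /derive1; set d := (fun _ : R => _); set d' := (fun _ : R => _).
  suff -> : d = d' by [].
  by apply/funext => t; rewrite /d /d' /= addr0 scale0r add0r.
split.
  apply/derivable1P; apply/derivable1_diffP.
  by apply: (@differentiable_comp _ _ _ _ F h); exact/derivable1_diffP.
by rewrite !DE -/F (derive1_comp dF dh') /F scale0r add0r.
Qed.

(** By the chain rule D_i (h o f) is (h' o f) D_i f, a product of functions
    with one derivative fewer: the induction is on the order. *)
Lemma Ck_comp1 k (h : R -> R) f :
  (forall m t, derivable (derive1n m h) t 1) -> Ck k setT f -> Ck k setT (h \o f).
Proof.
elim: k h f => [|k IH] h f hs Cf; have [cf df] := Cf.
  split => // x _; apply: continuous_comp; first exact: cf.
  by apply/differentiable_continuous/derivable1_diffP; exact: (hs 0).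
split.
  move=> x _; apply: continuous_comp; first exact: cf.
  by apply/differentiable_continuous/derivable1_diffP; exact: (hs 0).
move=> i; have [fi Dfi] := df i; split.
  by move=> x _; apply: (derive_comp1 (fi x I) (hs 0 _)).1.
rewrite (_ : 'D_'e_i (h \o f) = (derive1 h \o f) * 'D_'e_i f); last first.
  by apply/funext => x; exact: (derive_comp1 (fi x I) (hs 0 _)).2.
apply: CkM => //; apply: IH; last exact: CkW.
by move=> m t; rewrite -derive1Sn; exact: hs.
Qed.

Lemma is_derive_coord (x v : 'rV[R]_n) j :
  is_derive x v (fun y : 'rV[R]_n => y ord0 j) (v ord0 j).
Proof.
apply: DeriveDef.
  by apply: diff_derivable; exact: differentiable_coord.
rewrite /derive; apply: lim_near_cst => //.
near=> t; rewrite /= !mxE addrK /GRing.scale /=.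
by rewrite mulrA mulVf ?mul1r//; near: t; exact: nbhs_dnbhs_neq.
Unshelve. all: by end_near. Qed.

Lemma Ck_coord k j : Ck k setT (fun y : 'rV[R]_n => y ord0 j).
Proof.
case: k => [|k]; split => //; try by move=> x _; exact: coord_continuous.
move=> i; split.
  by move=> x _; case: (is_derive_coord x 'e_i j).
rewrite (_ : 'D_'e_i _ = cst (('e_i : 'rV[R]_n) ord0 j)); first exact: Ck_cst.
by apply/funext => x; have h := is_derive_coord x 'e_i j; rewrite derive_val.
Qed.

End smooth_functions.

Section flat.
Context {R : realType}.
Implicit Types (P : {poly R}) (t : R).

(** The functions P(1/t) exp(-1/t), extended by 0 to t <= 0. This family is
    closed under derivation, which makes all its members smooth at once. *)
Definition flat P t : R := if 0 < t then P.[t^-1] * expR (- t^-1) else 0.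

Lemma is_derive_horner P t : is_derive t 1 (horner P) P^`().[t].
Proof.
elim/poly_ind: P => [|P c IH].
  rewrite (_ : horner 0 = cst 0); last by apply/funext => y; rewrite horner0.
  by rewrite deriv0 horner0; exact: is_derive_cst.
rewrite (_ : horner _ = (horner P) * id + cst c); last first.
  by apply/funext => y; rewrite hornerMXaddC.
apply: is_derive_eq.
by rewrite derivD derivM derivX derivC mulr1 addr0 !hornerE /GRing.scale/=; lra.
Qed.

(** The exponential beats every polynomial in 1/t; the second power of t is
    what makes the derivative at 0 exist and vanish. *)
Lemma flat_le P : exists C, forall t, t <= 1 -> `|flat P t| <= C * t ^+ 2.
Proof.
pose A := \sum_(i < size P) `|P`_i|.
exists (A * (size P).+2`!%:R) => t t1.
have A0 : 0 <= A by apply: sumr_ge0.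
rewrite /flat; case: ifPn => [t0|_]; last first.
  by rewrite normr0 mulr_ge0// ?sqr_ge0// mulr_ge0.
set y := t^-1; have y1 : 1 <= y by rewrite invf_ge1.
have y0 : 0 < y by rewrite invr_gt0.
have PA : `|P.[y]| <= A * y ^+ size P.
  rewrite horner_coef; apply: le_trans (ler_norm_sum _ _ _) _.
  rewrite mulr_suml; apply: ler_sum => i _; rewrite normrM.
  apply: ler_pM => //; rewrite normrX (ger0_norm (ltW y0)).
  by apply: ler_weXn2l => //; exact: ltnW.
rewrite normrM (ger0_norm (expR_ge0 _)) expRN.
rewrite -[t]invrK -/y exprVn ler_pdivrMr ?expR_gt0//.
apply: (le_trans PA); rewrite -!mulrA; apply: ler_wpM2l => //.
have := expR_ge1Dxn (size P).+1 (ltW y0) => h.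
have {}h : y ^+ (size P).+2 <= (size P).+2`!%:R * expR y.
  rewrite mulrC -ler_pdivrMr ?ltr0n ?fact_gt0//.
  by apply: le_trans h; rewrite lerDr.
rewrite mulrCA -ler_pdivrMl ?invr_gt0 ?exprn_gt0// invrK -exprD.
by rewrite add2n.
Qed.

Lemma is_derive_flat P t : is_derive t 1 (flat P) (flat ('X^2 * (P - P^`())) t).
Proof.
have [t0|t0|->] := ltgtP t 0.
- apply: (@near_eq_is_derive _ _ _ (cst 0)).
    by near=> s; rewrite /flat ltNge ltW//; near: s; exact: lt_nbhsl.
  rewrite /flat ltNge ltW//=; exact: is_derive_cst.
- pose iv (s : R) := s^-1.
  have div : is_derive t 1 iv (- t ^- 2).
    have h : is_derive t 1 (id : R -> R) 1 by exact: is_derive_id.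
    have t_neq0 : id t != 0 by rewrite gt_eqF.
    by have := is_deriveV t_neq0 h; rewrite /GRing.scale/= mulr1.
  have d1 : is_derive t 1 (horner P \o iv) (P^`().[t^-1] * (- t ^- 2)).
    by apply: is_derive1_comp; exact: is_derive_horner.
  have d2 : is_derive t 1 (expR \o (- iv)) (expR (- t^-1) * (t ^- 2)).
    apply: is_derive1_comp; rewrite -[X in is_derive _ _ _ X]opprK.
    exact: is_deriveN.
  apply: (@near_eq_is_derive _ _ _ ((horner P \o iv) * (expR \o (- iv)))).
    by near=> s; rewrite /flat ifT//; near: s; exact: lt_nbhsr.
  rewrite /flat t0; apply: is_derive_eq.
  rewrite /GRing.scale/= !hornerE -!exprVn /iv/=.
  by change ((- [eta GRing.inv]) t) with (- t^-1); ring.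
- have [C Cle] := flat_le P.
  suff cv : (fun h : R => h^-1 *: (flat P (h *: 1 + 0) - flat P 0)) @ 0^' --> (0:R).
    rewrite [X in is_derive _ _ _ X](_ : _ = 0); last by rewrite /flat ltxx.
    by apply: DeriveDef; [apply/cvg_ex; exists 0|apply: cvg_lim].
  apply: norm_cvg0.
  apply: (@squeeze_cvgr _ _ _ _ (cst 0) (fun h : R => `|C| * `|h|)).
  + near=> h; rewrite normr_ge0/=.
    have h0 : h != 0 by near: h; exact: nbhs_dnbhs_neq.
    have h1 : h <= 1.
      apply: le_trans (ler_norm _) _; apply: ltW.
      by near: h; exact: dnbhs0_lt.
    rewrite [X in _ - X]/flat ltxx subr0 addr0 /GRing.scale/= mulr1 normrM normfV.
    rewrite ler_pdivrMl ?normr_gt0//.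
    apply: le_trans (Cle _ h1) _; rewrite [leRHS]mulrCA -[in leRHS]expr2 real_normK ?num_real//.
    by apply: ler_wpM2r; rewrite ?sqr_ge0// ler_norm.
  + exact: cvg_cst.
  + rewrite -[X in _ --> X](mulr0 `|C|); apply: cvgMl_tmp.
    rewrite -[X in _ --> X](@normr0 _ R); apply: cvg_norm.
    exact: nbhs_dnbhs.
Unshelve. all: by end_near. Qed.

Lemma derivable_flat m P t : derivable (derive1n m (flat P)) t 1.
Proof.
have DE Q : derive1 (flat Q) = flat ('X^2 * (Q - Q^`())).
  apply/funext => s; rewrite derive1E; have h := is_derive_flat Q s.
  by rewrite derive_val.
elim: m P => [|m IH] P; first by case: (is_derive_flat P t).
by rewrite derive1Sn DE.
Qed.

End flat.

Lemma ball_rVP (R : realType) n (x y : 'rV[R]_n) r : 0 < r ->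
  ball x r y <-> forall i, `|y ord0 i - x ord0 i| < r.
Proof.
move=> r0; split => [[_ h] i|h]; first by rewrite distrC; exact: h.
by split => // i j; rewrite (ord1 i) /ball/= distrC; exact: h.
Qed.

Section bump.
Context {R : realType}.

Let h : R -> R := flat 1.

Let hE t : h t = if 0 < t then expR (- t^-1) else 0.
Proof. by rewrite /h /flat hornerE mul1r. Qed.

Let h_ge0 t : 0 <= h t.
Proof. by rewrite hE; case: ifP => // _; exact: expR_ge0. Qed.

Let h_le s t : s <= t -> h s <= h t.
Proof.
move=> st; rewrite !hE; case: ifPn => [s0|_]; last by case: ifP => // _; exact: expR_ge0.
have t0 : 0 < t by exact: lt_le_trans st.
by rewrite t0 ler_expR lerN2 lef_pV2// posrE.
Qed.

Let h_gt0 t : 0 < t -> 0 < h t.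
Proof. by move=> t0; rewrite hE t0 expR_gt0. Qed.

Let h_le1 t : h t <= 1.
Proof.
rewrite hE; case: ifPn => // t0; rewrite -expR0 ler_expR oppr_le0.
by rewrite invr_ge0 ltW.
Qed.

Let h0 t : t <= 0 -> h t = 0.
Proof. by move=> t0; rewrite hE ltNge t0. Qed.

Let derivable_h m t : derivable (derive1n m h) t 1.
Proof. exact: derivable_flat. Qed.

Let derivable_h0 t : derivable h t 1.
Proof. exact: (@derivable_h 0%N t). Qed.

Let dhE : derive1 h = flat ('X^2 * (1 - 1^`())).
Proof.
apply/funext => s; rewrite derive1E; have hs := is_derive_flat 1 s.
by rewrite derive_val.
Qed.

Let dh_bounded : exists B, 0 <= B /\ forall t, t <= 1 -> `|derive1 h t| <= B.
Proof.
have [C Ct] := flat_le ('X^2 * (1 - 1^`()) : {poly R}).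
have C0 : 0 <= C by have := Ct 1 (lexx _); rewrite expr1n mulr1; apply: le_trans.
exists C; split => // t t1; rewrite dhE.
have [t0|t0] := leP t 0.
  by rewrite /flat ltNge t0/= normr0.
apply: le_trans (Ct _ t1) _; rewrite ler_piMr// expr_le1// ltW//.
Qed.

Let a := h 1.
Let a0 : 0 < a. Proof. exact: h_gt0. Qed.
Let ha0 : 0 < h a. Proof. exact: h_gt0. Qed.

(** With h = flat 1, which is 0 on the negative axis and nondecreasing, and
    a = h 1, the function h (a - h t) / h a is 1 for t <= 0 and 0 for t >= 1.
    It is composed with a quadratic polynomial which is <= 0 on the ball and
    >= 1 off the larger ball. *)
Lemma smooth_bump n : exists2 C : R, 0 <= C &
  forall (x : 'rV[R]_n) r, 0 < r -> exists phi : 'rV[R]_n -> R,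
    [/\ forall k, Ck k setT phi,
        forall y, 0 <= phi y <= 1,
        forall y, ball x r y -> phi y = 1,
        forall y, ~ ball x (n.+1%:R * r) y -> phi y = 0 &
        forall y i, `|'D_'e_i phi y| <= C / r * \1_(ball x (n.+1%:R * r)) y].
Proof.
have [B [B0 dhB]] := dh_bounded.
exists ((h a)^-1 * B * B * (2 * n.+1%:R)).
  by rewrite !mulr_ge0// invr_ge0 ltW.
move=> x r r0.
have nr0 : 0 < n.+1%:R * r :> R by rewrite mulr_gt0.
pose c i : 'rV[R]_n -> R := cst (r^-1) * ((fun y : 'rV[R]_n => y ord0 i) + cst (- x ord0 i)).
have cE i y : c i y = (y ord0 i - x ord0 i) / r by rewrite mulrC.
have cS k i : Ck k setT (c i).
  apply: CkM; first exact: Ck_cst.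
  by apply: CkD; [exact: Ck_coord|exact: Ck_cst].
(* q y is the sum of the ((y_i - x_i) / r)^2, minus n. *)
pose q : 'rV[R]_n -> R := (\sum_i c i * c i) + cst (- n%:R).
have qE y : q y = \sum_i (c i y) ^+ 2 - n%:R.
  rewrite /q; change ((\sum_i c i * c i) y + (- n%:R) = \sum_i c i y ^+ 2 - n%:R).
  by congr (_ + _); rewrite fct_sumE; apply: eq_bigr => i _; rewrite expr2.
have qS k : Ck k setT q.
  apply: CkD; last exact: Ck_cst.
  apply: (@big_ind _ (Ck k setT)) => [|f g|i _]; first exact: Ck_cst.
  - exact: CkD.
  - exact: CkM.
have Dc i j y : 'D_'e_i (c j) y = r^-1 * (i == j)%:R.
  have h1 := is_derive_coord y 'e_i j.
  have d1 : derivable (fun z : 'rV[R]_n => z ord0 j) y 'e_i by case: h1.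
  have d2 := @derivable_cst _ _ R^o (- x ord0 j) y 'e_i.
  rewrite /c (deriveM (derivable_cst _ _ _) (derivableD d1 d2)).
  rewrite derive_cst scaler0 addr0 (deriveD d1 d2).
  by rewrite derive_cst addr0 derive_val /= !mxE/= eq_sym.
have dc i j y : derivable (c j) y 'e_i by have [_ /(_ i)[/(_ y I)]] := cS 1 j.
have Dq i y : 'D_'e_i q y = 2 * c i y / r.
  rewrite /q (deriveD _ (derivable_cst _ _ _)); last first.
    by apply: derivable_sum => j; apply: derivableM.
  rewrite derive_cst addr0 derive_sum; last by move=> j; apply: derivableM.
  rewrite (bigD1 i)//= big1 ?addr0 => [|j ji].
    by rewrite deriveM// Dc eqxx mulr1 /GRing.scale/=; lra.
  by rewrite deriveM// Dc eq_sym (negPf ji) mulr0 scaler0 addr0.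
have dq i y : derivable q y 'e_i by have [_ /(_ i)[/(_ y I)]] := qS 1.
have far y : ~ ball x (n.+1%:R * r) y -> 1 <= q y.
  move=> /(ball_rVP _ _ nr0)/existsNP[i /negP]; rewrite -leNgt => yi.
  rewrite qE (bigD1 i)//= -addrA.
  suff : n.+1%:R <= c i y ^+ 2.
    have : 0 <= \sum_(j < n | j != i) c j y ^+ 2 by apply: sumr_ge0 => j _; exact: sqr_ge0.
    by rewrite -natr1; lra.
  have ci : n.+1%:R <= `|c i y|.
    by rewrite cE normrM normfV (gtr0_norm r0) ler_pdivlMr.
  rewrite -real_normK ?num_real// expr2; apply: (le_trans ci).
  by rewrite ler_peMl// (le_trans _ ci)// ler1n.
pose phi := cst (h a)^-1 * (h \o (cst a + cst (-1) * (h \o q))).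
have phiE y : phi y = (h a)^-1 * h (a - h (q y)).
  rewrite /phi; change ((h a)^-1 * h (a + (-1) * h (q y)) = (h a)^-1 * h (a - h (q y))).
  by rewrite mulN1r.
have phi0 y : 1 <= q y -> phi y = 0.
  by move=> /h_le qy; rewrite phiE [h (a - _)]h0 ?mulr0// subr_le0.
have hqS k : Ck k setT (cst a + cst (-1) * (h \o q)).
  apply: CkD; first exact: Ck_cst.
  by apply: CkM; [exact: Ck_cst|apply: Ck_comp1 => //; exact: derivable_h].
have phiS k : Ck k setT phi.
  by apply: CkM; [exact: Ck_cst|apply: Ck_comp1 => //; exact: derivable_h].
have Dphi i y : 'D_'e_i phi y =
    (h a)^-1 * (derive1 h (a - h (q y)) * (- (derive1 h (q y) * (2 * c i y / r)))).
  have [d1 e1] := derive_comp1 (dq i y) (@derivable_h0 (q y)).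
  have d2 : derivable (cst a + cst (-1) * (h \o q)) y 'e_i.
    by have [_ /(_ i)[/(_ y I)]] := hqS 1.
  have [d3 e3] := derive_comp1 d2 (@derivable_h0 _).
  rewrite /phi (deriveM (derivable_cst _ _ _) d3) derive_cst scaler0 addr0 e3.
  have dc1 := @derivable_cst _ _ R^o (-1 : R) y 'e_i.
  rewrite (deriveD (derivable_cst _ _ _) (derivableM dc1 d1)).
  rewrite (deriveM dc1 d1) !derive_cst scaler0 addr0 add0r e1 Dq.
  rewrite (_ : (cst a + cst (-1) * (h \o q)) y = a - h (q y)); last first.
    change (a + (-1) * h (q y) = a - h (q y)).
    by rewrite mulN1r.
  by rewrite /GRing.scale/= mulN1r.
exists phi; split => //.
- move=> y; rewrite phiE mulr_ge0 ?invr_ge0 ?(ltW ha0)//=.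
  by rewrite ler_pdivrMl// mulr1 h_le// gerBl.
- move=> y /(ball_rVP _ _ r0) yr; rewrite phiE [h (q y)]h0.
    by rewrite subr0 mulVf// gt_eqF.
  rewrite qE subr_le0 -[n in leRHS]card_ord -sum1_card natr_sum.
  apply: ler_sum => i _; rewrite -real_normK ?num_real// expr_le1//.
  by rewrite cE normrM normfV (gtr0_norm r0) ler_pdivrMr// mul1r ltW.
- by move=> y /far /phi0.
- move=> y i; rewrite Dphi; move: (c i y) (cE i y) => ciy ciyE.
  have [q1|q1] := leP 1 (q y).
    rewrite (_ : derive1 h (a - h (q y)) = 0); last first.
      by rewrite dhE /flat ltNge subr_le0 [a <= _]h_le.
    by rewrite mul0r mulr0 normr0 mulr_ge0// divr_ge0 ?(ltW r0)// !mulr_ge0// invr_ge0 ltW.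
  have yb : ball x (n.+1%:R * r) y by apply: contrapT => /far; rewrite leNgt q1.
  rewrite indicE mem_set// mulr1 normrM (ger0_norm (_ : 0 <= (h a)^-1)) ?invr_ge0 ?(ltW ha0)//.
  rewrite -!mulrA; apply: ler_wpM2l; first by rewrite invr_ge0 ltW.
  rewrite normrM; apply: ler_pM => //.
    apply: dhB; rewrite lerBlDr (le_trans (h_le1 _))// lerDl; exact: h_ge0.
  rewrite normrN normrM; apply: ler_pM => //; first exact/dhB/ltW.
  rewrite normrM ger0_norm//; apply: ler_wpM2l => //.
  rewrite normrM normfV (gtr0_norm r0); apply: ler_wpM2r; first by rewrite invr_ge0 ltW.
  rewrite ciyE normrM normfV (gtr0_norm r0) ler_pdivrMr//.
  by apply: ltW; move/(ball_rVP _ _ nr0) : yb; exact.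
Qed.

End bump.

(** * Integrals of partial derivatives *)

Section borel_rV.
Context {R : realType} {n : nat}.

Lemma continuous_measurable_rV (f : 'rV[R]_n -> R) :
  continuous f -> measurable_fun setT f.
Proof.
move=> cf; apply: (@continuous_measurable_rV_fun R n _ (measurableTypeR R)
  (@RGenOpens.G R)); first exact: RGenOpens.measurableE.
move=> _ [a [b ->]]; apply: open_comp; last exact: interval_open.
by move=> v _; exact: cf.
Qed.

Lemma closed_measurable_rV (A : set 'rV[R]_n) : closed A -> measurable A.
Proof.
by move=> cA; rewrite -[A]setCK; apply: measurableC; apply: open_measurable_mx;
  exact: closed_openC.
Qed.

Lemma compact_closed_rV (A : set 'rV[R]_n) : compact A -> closed A.
Proof. by apply: compact_closed; exact: norm_hausdorff. Qed.

Lemma compact_measurable_rV (A : set 'rV[R]_n) : compact A -> measurable A.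
Proof. by move=> /compact_closed_rV; exact: closed_measurable_rV. Qed.

Lemma lebesgue_ball (x : 'rV[R]_n) r : 0 < r ->
  lebesgue_rV n (ball x r) = ((2 * r) ^+ n)%:E.
Proof.
move=> r0.
pose A i : set R := `](x ord0 i - r), (x ord0 i + r)[%classic.
rewrite (_ : ball x r = [set v | forall i, A i (v ord0 i)]).
  rewrite (@lebesgue_rV_box R n A); last by move=> i; exact: measurable_itv.
  under eq_bigr do rewrite /A lebesgue_measure_itv/= lte_fin.
  rewrite (eq_bigr (fun=> (2 * r)%:E)); last first.
    move=> i _; rewrite ifT; last by lra.
    by rewrite -EFinB; congr EFin; lra.
  by rewrite prodEFin prodr_const card_ord.
apply/seteqP; split => y /=.
  move=> /(ball_rVP _ _ r0) h i; have := h i; rewrite /A /= in_itv/= ltr_norml; lra.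
move=> h; apply/ball_rVP => // i; have := h i; rewrite /A /= in_itv/= ltr_norml; lra.
Qed.

Lemma compact_sub_ball (K : set 'rV[R]_n) : compact K ->
  exists2 M, 0 < M & K `<=` ball 0 M.
Proof.
move=> /compact_bounded[M [_ hM]].
exists (`|M| + 2); first by rewrite ltr_wpDl.
move=> x Kx; rewrite -ball_normE /ball_/= sub0r normrN.
apply: (@le_lt_trans _ _ (`|M| + 1)); last by lra.
by apply: hM => //; have := ler_norm M; lra.
Qed.

Lemma compact_lebesgue (K : set 'rV[R]_n) : compact K ->
  (lebesgue_rV n K < +oo)%E.
Proof.
move=> cK; have [M M0 KM] := compact_sub_ball cK.
apply: (@le_lt_trans _ _ (lebesgue_rV n (ball 0 M))).
  apply: le_measure => //; rewrite inE; first exact: compact_measurable_rV.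
  by apply: open_measurable_mx; exact: ball_open.
by rewrite lebesgue_ball// ltry.
Qed.

Lemma measurable_ball_rV (x : 'rV[R]_n) r : measurable (ball x r).
Proof. by apply: open_measurable_mx; exact: ball_open. Qed.

Lemma continuous_compact_bounded (f : 'rV[R]_n -> R) K : continuous f ->
  compact K -> exists2 C, 0 <= C & forall x, K x -> `|f x| <= C.
Proof.
move=> cf cK; have [->|/set0P K0] := eqVneq K set0; first by exists 0.
have [|c _ hc] := @EVT_max_rV R n (fun x => `|f x|) K K0 cK.
  apply: continuous_subspaceT => x; apply: continuous_comp; first exact: cf.
  exact: norm_continuous.
by exists `|f c| => // x Kx; apply: hc; rewrite inE.
Qed.

Lemma integrable_bounded (f : 'rV[R]_n -> R) (D : set 'rV[R]_n) C :
  measurable D -> (lebesgue_rV n D < +oo)%E -> measurable_fun D f ->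
  (forall x, D x -> `|f x| <= C) -> (lebesgue_rV n).-integrable D (EFin \o f).
Proof.
move=> mD Doo mf fC; apply: (@le_integrable _ _ _ _ _ mD _ (EFin \o cst C)).
- exact/measurable_EFinP.
- by move=> x Dx /=; rewrite lee_fin (le_trans (fC x Dx))// ler_norm.
- apply/integrableP; split; first by apply/measurable_EFinP; exact: measurable_cst.
  by rewrite /= integral_cst//= lte_mul_pinfty.
Qed.

End borel_rV.

Section partial_derivative_integral.
Context {R : realType}.

Lemma integral_derive1_eq0 (g : R -> R) M : (forall x, derivable g x 1) ->
  continuous (derive1 g) -> (forall x, M <= `|x| -> g x = 0) ->
  (\int[lebesgue_measure]_x (derive1 g x)%:E = 0)%E.
Proof.
move=> dg cg g0; pose N := `|M| + 1.
have MN : M <= N by rewrite (le_trans (ler_norm M))// lerDl.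
have N0 : 0 < N by rewrite ltr_wpDl.
rewrite (_ : (fun x => (derive1 g x)%:E) =
    (fun x => (derive1 g x)%:E) \_ `[- N, N]%classic).
  rewrite -integral_mkcond (@continuous_FTC2 _ _ g)//.
  - by rewrite !g0 ?subee// ?normrN ger0_norm// ltW.
  - by lra.
  - exact: continuous_subspaceT.
  - split => [x _||]; first exact: dg.
    + apply: cvg_at_right_filter.
      exact/differentiable_continuous/derivable1_diffP/dg.
    + apply: cvg_at_left_filter.
      exact/differentiable_continuous/derivable1_diffP/dg.
apply/funext => x; rewrite /patch; case: ifPn => //.
rewrite notin_setE/= in_itv/= => /negP xN.
have Nx : N < `|x|.
  by rewrite ltNge; apply: contra xN; rewrite ler_norml.
congr EFin; rewrite derive1E (@near_eq_derive _ _ _ _ (cst 0)) ?derive_cst//.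
near=> y; apply: g0; apply: (le_trans MN); apply: ltW; near: y.
by apply: (cvgr_gt `|x|) => //; exact: norm_continuous.
Unshelve. all: by end_near. Qed.

Lemma consrV_shift0 n (x t : R) (v : 'rV[R]_n) :
  t *: 'e_ord0 + consrV (x, v) = consrV (t + x, v).
Proof.
apply/rowP => i; rewrite mxE; case: (unliftP ord0 i) => [j ->|->].
  by rewrite !consrVS !mxE eqxx/= mulr0 add0r.
by rewrite !consrV0 !mxE/= mulr1.
Qed.

Lemma consrV_shiftS n (x t : R) (v : 'rV[R]_n) j :
  t *: 'e_(lift ord0 j) + consrV (x, v) = consrV (x, t *: 'e_j + v).
Proof.
apply/rowP => i; rewrite mxE; case: (unliftP ord0 i) => [k ->|->].
  by rewrite !consrVS !mxE eqxx/= (inj_eq lift_inj).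
by rewrite !consrV0 !mxE eqxx/= mulr0 add0r.
Qed.

Lemma ball_consrV_in n (x : R) (v w : 'rV[R]_n) r :
  ball v r w -> ball (consrV (x, v)) r (consrV (x, w)).
Proof. by move=> vw; apply: ball_consrV => //=; apply: ballxx; case: vw. Qed.

Lemma continuous_consrVr n (x : R) : continuous (fun v : 'rV[R]_n => consrV (x, v)).
Proof.
move=> v A /nbhs_ballP[e e0 eA]; apply/nbhs_ballP; exists e => // w vw.
by apply: eA; exact: ball_consrV_in.
Qed.

Lemma continuous_consrVl n (v : 'rV[R]_n) :
  continuous (fun x : R => consrV (x, v)).
Proof.
move=> x A /nbhs_ballP[e e0 eA]; apply/nbhs_ballP; exists e => // y xy.
by apply/eA/ball_consrV => //=; exact: ballxx.
Qed.

Lemma ball0_consrV n (x : R) (v : 'rV[R]_n) r : ball 0 r (consrV (x, v)) ->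
  `|x| < r /\ ball 0 r v.
Proof.
move=> h; have r0 : 0 < r by case: h.
move/(ball_rVP _ _ r0) : h => h; split.
  by have := h ord0; rewrite consrV0 mxE subr0.
by apply/ball_rVP => // i; have := h (lift ord0 i); rewrite consrVS !mxE.
Qed.

Lemma is_derive_slice0 n (phi : 'rV[R]_n.+1 -> R) x (v : 'rV[R]_n) :
  derivable phi (consrV (x, v)) 'e_ord0 ->
  is_derive x 1 (fun t : R => phi (consrV (t, v))) ('D_'e_ord0 phi (consrV (x, v))).
Proof.
move=> dphi.
have E : (fun h : R => h^-1 *: (((fun t : R => phi (consrV (t, v))) \o shift x) (h *: 1)
      - phi (consrV (x, v)))) =
    (fun h : R => h^-1 *: ((phi \o shift (consrV (x, v))) (h *: 'e_ord0)
      - phi (consrV (x, v)))).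
  by apply/funext => h; rewrite /= consrV_shift0 /GRing.scale/= mulr1.
by apply: DeriveDef; rewrite /derivable /derive E.
Qed.

Lemma is_derive_sliceS n (phi : 'rV[R]_n.+1 -> R) x (v : 'rV[R]_n) j :
  derivable phi (consrV (x, v)) 'e_(lift ord0 j) ->
  is_derive v 'e_j (fun w => phi (consrV (x, w)))
    ('D_'e_(lift ord0 j) phi (consrV (x, v))).
Proof.
move=> dphi.
have E : (fun h : R => h^-1 *: (((fun w => phi (consrV (x, w))) \o shift v) (h *: 'e_j)
      - phi (consrV (x, v)))) =
    (fun h : R => h^-1 *: ((phi \o shift (consrV (x, v))) (h *: 'e_(lift ord0 j))
      - phi (consrV (x, v)))).
  by apply/funext => h; rewrite /= consrV_shiftS.
by apply: DeriveDef; rewrite /derivable /derive E.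
Qed.

Lemma derive_eq0_outside n (phi : 'rV[R]_n -> R) (K : set 'rV[R]_n) v x :
  closed K -> (forall y, ~ K y -> phi y = 0) -> ~ K x -> 'D_v phi x = 0.
Proof.
move=> cK phi0 Kx; rewrite (@near_eq_derive _ _ _ _ (cst 0)) ?derive_cst//.
have : nbhs x (~` K) by apply: open_nbhs_nbhs; split => //; exact: closed_openC.
by apply: filterS => y; exact: phi0.
Qed.

(** By Fubini, peeling off the first coordinate: if the derivative is taken
    along it, the inner one-dimensional integral vanishes by the fundamental
    theorem of calculus; otherwise it vanishes by induction on the dimension. *)
Lemma integral_partial_eq0 n (phi : 'rV[R]_n -> R) i K :
  compact K -> (forall y, ~ K y -> phi y = 0) ->
  (forall x, derivable phi x 'e_i) -> continuous ('D_'e_i phi) ->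
  (\int[lebesgue_rV n]_x ('D_'e_i phi x)%:E = 0)%E.
Proof.
elim: n phi i K => [phi [//]|n IH phi i K cK phi0 dphi cD].
have [M M0 KM] := compact_sub_ball cK.
have mD : measurable_fun setT ('D_'e_i phi) by exact: continuous_measurable_rV.
have D0 y : ~ K y -> 'D_'e_i phi y = 0.
  by move=> Ky; apply: (@derive_eq0_outside _ _ K) => //; exact: compact_closed_rV.
have intD : (lebesgue_rV n.+1).-integrable setT (EFin \o 'D_'e_i phi).
  have [C C0 DC] := continuous_compact_bounded cD cK.
  have -> : EFin \o 'D_'e_i phi = (EFin \o 'D_'e_i phi) \_ K.
    apply/funext => y; rewrite /patch; case: ifPn => //; rewrite notin_setE => Ky.
    by rewrite /= D0.
  apply/(integrable_mkcond _ (compact_measurable_rV cK)).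
  apply: (@integrable_bounded _ _ _ _ C) => //; first exact: compact_measurable_rV.
  - exact: compact_lebesgue.
  - exact: measurable_funTS.
pose F (p : measurableTypeR R * 'rV[R]_n) := ('D_'e_i phi (consrV p))%:E.
have mF : measurable_fun setT F.
  by apply/measurable_EFinP; exact: (measurableT_comp mD (@measurable_consrV R n)).
have intF : (lebesgue_measure \x lebesgue_rV n)%E.-integrable setT F.
  apply/integrableP; split => //; move/integrableP : intD => [_].
  rewrite /=  (@ge0_integral_pushforward _ _ _ _ _ _ (@measurable_consrV R n))//.
  by apply/measurable_EFinP; apply: measurableT_comp.
have -> : (\int[lebesgue_rV n.+1]_x ('D_'e_i phi x)%:E =
    \int[lebesgue_measure \x lebesgue_rV n]_p F p)%E.
  rewrite /= (@integral_pushforward _ _ _ _ _ _ (@measurable_consrV R n))//.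
  exact/measurable_EFinP.
case: (unliftP ord0 i) => [j ij|i0].
  rewrite -(integral12_prod_meas1 intF)/=.
  rewrite integral0_eq// => x _; rewrite /fubini_F /F ij.
  have E v : 'D_'e_(lift ord0 j) phi (consrV (x, v)) =
      'D_'e_j (fun w => phi (consrV (x, w))) v.
    by have /is_derive_sliceS[_ ->] : derivable phi (consrV (x, v)) 'e_(lift ord0 j)
      by rewrite -ij; exact: dphi.
  under eq_integral do rewrite E.
  apply: (IH _ _ [set v | forall k, `[- M, M]%classic (v ord0 k)]).
  + by apply: (@rV_compact R n (fun=> `[- M, M]%classic)) => k; exact: segment_compact.
  + move=> v vM; apply: phi0 => /KM /ball0_consrV[_ /(ball_rVP _ _ M0) vk].
    apply: vM => k /=; rewrite in_itv/= -ler_norml ltW//.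
    by have := vk k; rewrite mxE subr0.
  + move=> v.
    by have /is_derive_sliceS[] : derivable phi (consrV (x, v)) 'e_(lift ord0 j)
      by rewrite -ij; exact: dphi.
  + rewrite (_ : 'D_'e_j _ = (fun v => 'D_'e_(lift ord0 j) phi (consrV (x, v)))).
      move=> v; apply: (@continuous_comp _ _ _
        (fun w : 'rV[R]_n => consrV (x, w)) ('D_'e_(lift ord0 j) phi) v).
        exact: continuous_consrVr.
      by rewrite -ij; exact: cD.
    by apply/funext => v; rewrite E.
rewrite -(integral21_prod_meas1 intF)/=.
rewrite integral0_eq// => v _; rewrite /fubini_G /F i0.
have dE (x : R) : is_derive x 1 (fun t : R => phi (consrV (t, v)))
    ('D_'e_ord0 phi (consrV (x, v))).
  by apply: is_derive_slice0; rewrite -i0.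
have E x : 'D_'e_ord0 phi (consrV (x, v)) = derive1 (fun t : R => phi (consrV (t, v))) x.
  by rewrite derive1E; case: (dE x).
under eq_integral do rewrite E.
apply: (@integral_derive1_eq0 _ M) => [x||x Mx]; first by case: (dE x).
- rewrite (_ : derive1 _ = (fun x : R => 'D_'e_ord0 phi (consrV (x, v)))).
    move=> x; apply: (@continuous_comp _ _ _ (fun y : R => consrV (y, v)) ('D_'e_ord0 phi) x).
      exact: continuous_consrVl.
    by rewrite -i0; exact: cD.
  by apply/funext => x; rewrite E.
- by apply: phi0 => /KM /ball0_consrV[]; rewrite ltNge Mx.
Qed.

End partial_derivative_integral.

(** * Regularity of finite Borel measures *)

Lemma nonincreasing_measure_lt d (T : measurableType d) (R : realType)
    (mu : {measure set T -> \bar R}) (F : (set T)^nat) (e : \bar R) :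
  (mu (F 0%N) < +oo)%E -> (forall i, measurable (F i)) ->
  {homo F : n m / (n <= m)%N >-> m `<=` n} ->
  (mu (\bigcap_i F i) < e)%E ->
  exists N, forall k, (N <= k)%N -> (mu (F k) < e)%E.
Proof.
move=> F0 mF ndF Fe.
have mI : measurable (\bigcap_i F i) by apply: bigcap_measurable.
have ndF' : {homo F : n m / (n <= m)%N >-> (m <= n)%O}.
  by move=> n m nm; apply/subsetPset; exact: ndF.
have /(_ [set x | (x < e)%E])[] := @nonincreasing_cvg_mu _ _ _ mu F F0 mF mI ndF'.
- by apply: open_nbhs_nbhs; split => //; exact: open_ereal_lt_ereal.
- by move=> N _ NF; exists N.
Qed.

Section inner_erosion.
Context {R : realType} {n : nat}.
Implicit Types A : set 'rV[R]_n.

(** Erosions are closed, and those of an open set by 1/(k+1) exhaust it: this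
    is how open sets are approximated from inside. *)
Definition erosion A r : set 'rV[R]_n := [set x | ball x r `<=` A].

Lemma erosion_sub A r : 0 < r -> erosion A r `<=` A.
Proof. by move=> r0 x; apply; exact: ballxx. Qed.

Lemma erosion_le A r s : s <= r -> erosion A r `<=` erosion A s.
Proof. by move=> sr x xr y xy; apply: xr; exact: le_ball xy. Qed.

Lemma closed_erosion A r : closed (erosion A r).
Proof.
rewrite -openC (_ : ~` _ = \bigcup_(y in ~` A) ball y r).
  by apply: bigcup_open => y _; exact: ball_open.
apply/seteqP; split => [x /existsNP[y /not_implyP[xy Ay]]|x [y Ay yx] h].
  by exists y => //; exact: ball_sym.
by apply: Ay; apply: h; exact: ball_sym.
Qed.

Lemma open_erosion A x : open A -> A x ->
  exists k, forall m, (k <= m)%N -> erosion A m.+1%:R^-1 x.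
Proof.
move=> oA Ax; have /nbhs_ballP[e /= e0 eA] : nbhs x A by exact: open_nbhs_nbhs.
have [k _ kP] := near_infty_natSinv_lt (PosNum e0).
exists k => m km y xy; apply: eA; apply: le_ball xy.
by apply: ltW; exact: (kP m km).
Qed.

End inner_erosion.

Section regularity.
Context {R : realType} {n : nat}.

(** The sets that are squeezed between a closed and an open set up to small
    measure form a sigma-algebra, and open sets are among them because their
    erosions exhaust them. *)
Lemma borel_regularity (mu : {measure set 'rV[R]_n -> \bar R})
    (A : set 'rV[R]_n) :
  (mu setT < +oo)%E -> measurable A -> forall e, 0 < e ->
  exists C U, [/\ closed C, open U, C `<=` A, A `<=` U & (mu (U `\` C) < e%:E)%E].
Proof.
move=> muoo mA.
have fin B : measurable B -> (mu B < +oo)%E.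
  by move=> mB; apply: le_lt_trans muoo; apply: le_measure; rewrite ?inE.
have mo (B : set 'rV[R]_n) : open B -> measurable B by exact: open_measurable_mx.
have mc := @closed_measurable_rV R n.
pose D := [set A : set 'rV[R]_n | forall e, 0 < e -> exists C U,
  [/\ closed C, open U, C `<=` A, A `<=` U & (mu (U `\` C) < e%:E)%E]].
suff : <<s (@open 'rV[R]_n) >> `<=` D by move=> h; exact: h.
apply: smallest_sub; last first.
  (* Open sets are approximated by their erosions. *)
  move=> B oB e e0.
  pose F (k : nat) := B `\` erosion B k.+1%:R^-1.
  have mF k : measurable (F k).
    by apply: measurableD; [exact: mo|apply: mc; exact: closed_erosion].
  have [||N /(_ N (leqnn _)) FN] := @nonincreasing_measure_lt _ _ _ mu F e%:E (fin _ (mF _)) mF.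
  - move=> k m km; apply: setDS; apply: erosion_le.
    by rewrite lef_pV2 ?posrE ?ltr0n// ler_nat.
  - rewrite (_ : \bigcap_i F i = set0) ?measure0 ?lte_fin//.
    apply/seteqP; split => // x Fx; have [Bx _] := Fx 0 I.
    by have [k /(_ k (leqnn _)) kx] := open_erosion oB Bx; have [_] := Fx k I.
  - exists (erosion B N.+1%:R^-1), B; split => //; first exact: closed_erosion.
    by apply: erosion_sub; rewrite invr_gt0.
split.
- move=> e e0; exists set0, set0; split; [exact: closed0|exact: open0|by []|by []|].
  by rewrite setD0 measure0 lte_fin.
- move=> B DB e e0; have [C [U [cC oU CB BU Ue]]] := DB e e0.
  exists (~` U), (~` C); split.
  + exact: open_closedC.
  + exact: closed_openC.
  + by rewrite setTD; exact: subsetC.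
  + by rewrite setTD; exact: subsetC.
  + by rewrite setDE setCK setIC -setDE.
- move=> B DB e e0.
  have e20 : 0 < e / 2 by rewrite divr_gt0.
  have ek0 k : 0 < (e / 2) / (2 ^ k.+1)%:R by rewrite divr_gt0// ltr0n expn_gt0.
  have /choice[C hC] : forall k, exists C, exists U,
    [/\ closed C, open U, C `<=` B k, B k `<=` U & (mu (U `\` C) < ((e / 2) / (2 ^ k.+1)%:R)%:E)%E].
    by move=> k; exact: (DB k _ (ek0 k)).
  have {hC}/choice[U hU] := hC.
  pose V := \bigcup_k U k.
  have oV : open V by apply: bigcup_open => k _; have [] := hU k.
  pose F N := V `\` \big[setU/set0]_(k < N) C k.
  have cN N : closed (\big[setU/set0]_(k < N) C k).
    by apply: closed_bigsetU => k _; have [] := hU k.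
  have mF N : measurable (F N) by apply: measurableD; [exact: mo|exact: mc].
  have [||N /(_ N (leqnn _)) FN] := @nonincreasing_measure_lt _ _ _ mu F e%:E (fin _ (mF _)) mF.
  + by move=> k m km; apply: setDS; exact: subset_bigsetU.
  + apply: (@le_lt_trans _ _ (e / 2)%:E); last by rewrite lte_fin; lra.
    apply: le_trans (epsilon_trick0 xpredT (ltW e20)).
    apply: le_trans (_ : (\sum_(k <oo) mu (U k `\` C k) <= _)%E); last first.
      by apply: lee_nneseries => // k _; apply: ltW; have [] := hU k.
    apply: measure_sigma_subadditive.
    * by move=> k; have [? ? _ _ _] := hU k; apply: measurableD; [exact: mo|exact: mc].
    * exact: bigcap_measurable.
    * move=> x Fx; have [[k _ Ukx] _] := Fx 0 I; exists k => //; split => // Ckx.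
      have [_] := Fx k.+1 I; apply; rewrite -bigcup_mkord; exists k => //=.
  + exists (\big[setU/set0]_(k < N) C k), V; split => //.
    * rewrite -bigcup_mkord => x [k _ Ckx]; exists k => //.
      by have [_ _ + _ _] := hU k; exact.
    * by move=> x [k _ Bkx]; exists k => //; have [_ _ _ + _] := hU k; exact.
Qed.

Lemma compact_inner_regularity (mu : {measure set 'rV[R]_n -> \bar R})
    (K A : set 'rV[R]_n) :
  compact K -> (mu K < +oo)%E -> measurable A -> A `<=` K ->
  forall e, 0 < e -> exists C, [/\ compact C, C `<=` A & (mu (A `\` C) < e%:E)%E].
Proof.
move=> cK Koo mA AK e e0; have mK := compact_measurable_rV cK.
have [|C [U [cC oU CA AU Ue]]] := @borel_regularity (mrestr mu mK) A _ mA e e0.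
  by rewrite /= /mrestr setTI.
exists C; split => //.
  by apply: (subclosed_compact cC cK); exact: subset_trans AK.
apply: le_lt_trans Ue; rewrite /= /mrestr; apply: le_measure; rewrite ?inE.
- by apply: measurableD => //; exact: closed_measurable_rV.
- apply: measurableI => //; apply: measurableD; first exact: open_measurable_mx.
  exact: closed_measurable_rV.
- by move=> x [Ax Cx]; split; [split => //; exact: AU|exact: AK].
Qed.

End regularity.

(** * Scalar local measures and their Jordan decomposition *)

Section rel_compact_sets.
Context {R : realType} {n : nat}.
Implicit Types (O B E : set 'rV[R]_n).

Lemma rel_compactS O B E : rel_compact O E -> measurable B -> B `<=` E ->
  rel_compact O B.
Proof.
move=> [_ [K [cK KO EK]]] mB BE; split => //; exists K; split => //.
exact: subset_trans EK.
Qed.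

Lemma rel_compactU O B E : rel_compact O B -> rel_compact O E ->
  rel_compact O (B `|` E).
Proof.
move=> [mB [K [cK KO BK]]] [mE [L [cL LO EL]]]; split; first exact: measurableU.
exists (K `|` L); split; [exact: compactU|by move=> x [/KO|/LO]|exact: setUSS].
Qed.

Lemma rel_compact0 O : rel_compact O set0.
Proof. by split => //; exists set0; split => //; exact: compact0. Qed.

Lemma rel_compact_compact O K : compact K -> K `<=` O -> rel_compact O K.
Proof. by move=> cK KO; split; [exact: compact_measurable_rV|exists K; split]. Qed.

End rel_compact_sets.

Section scalar_local_measure.
Context {R : realType} {n : nat} (O : set 'rV[R]_n).
Implicit Types (lam : set 'rV[R]_n -> R).

(** The components of a vector-valued local measure; values are only
    meaningful on relatively compact sets. The prefix slm stands for the name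
    of this notion. *)
Definition scalar_local_measure lam :=
  forall F : (set 'rV[R]_n)^nat, (forall j, rel_compact O (F j)) ->
    trivIset setT F -> rel_compact O (\bigcup_j F j) ->
  (fun N => \sum_(j < N) lam (F j)) @ \oo --> lam (\bigcup_j F j).

Lemma scalar_local_measureN lam : scalar_local_measure lam ->
  scalar_local_measure (fun E => - lam E).
Proof.
move=> h F rF tF rU.
rewrite (_ : (fun N => \sum_(j < N) - lam (F j)) = -%R \o (fun N => \sum_(j < N) lam (F j))).
  by apply: cvgN; exact: h.
by apply/funext => N /=; rewrite sumrN.
Qed.

Section one_measure.
Variables (lam : set 'rV[R]_n -> R) (lamP : scalar_local_measure lam).

(** The partial sums for the constant sequence set0 converge, so their
    increments, all equal to lam set0, tend to 0. *)
Lemma slm0 : lam set0 = 0.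
Proof.
have h : (fun N => \sum_(j < N) lam set0) @ \oo --> lam set0.
  have := lamP (fun _ => @rel_compact0 R n O); rewrite bigcup0//; apply.
  - by apply/trivIsetP => i j _ _ _; rewrite setI0.
  - exact: rel_compact0.
have h1 : (fun N => \sum_(j < N.+1) lam set0) @ \oo --> lam set0.
  by have := h; rewrite -(cvg_shiftS (fun N => \sum_(j < N) lam set0)).
have h2 : (fun N => \sum_(j < N.+1) lam set0 - \sum_(j < N) lam set0) @ \oo --> (0 : R).
  by rewrite -[X in _ --> X](subrr (lam set0)); apply: cvgB.
rewrite -(cvg_lim (@Rhausdorff R) h2). apply: esym; apply: lim_near_cst => //.
by near=> N; rewrite big_ord_recr/= addrAC subrr add0r.
Unshelve. all: by end_near.
Qed.

Lemma slmU A B : rel_compact O A -> rel_compact O B -> A `&` B = set0 ->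
  lam (A `|` B) = lam A + lam B.
Proof.
move=> rA rB AB; rewrite -bigcup2E.
have h : (fun N => \sum_(j < N) lam (bigcup2 A B j)) @ \oo --> lam (\bigcup_j bigcup2 A B j).
  apply: lamP.
  - by move=> [|[|k]] => //; exact: rel_compact0.
  - by rewrite -trivIset_bigcup2.
  - by rewrite bigcup2E; exact: rel_compactU.
rewrite -(cvg_lim (@Rhausdorff R) h); apply: lim_near_cst => //; near=> N.
have N2 : (2 <= N)%N by near: N; exact: nbhs_infty_ge.
rewrite -(subnKC N2) big_split_ord/= 2!big_ord_recl big_ord0 /= addr0.
by rewrite big1 ?addr0// => i _; exact: slm0.
Unshelve. all: by end_near. Qed.

Lemma slm_split A B : rel_compact O A -> measurable B ->
  lam A = lam (A `&` B) + lam (A `\` B).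
Proof.
move=> rA mB; have mA := rA.1.
rewrite -slmU ?setUIDK//; last by rewrite setDE setIACA setICr setI0.
- by apply: rel_compactS rA _ _; [exact: measurableI|exact: subIsetl].
- by apply: rel_compactS rA _ _; [exact: measurableD|exact: subDsetl].
Qed.

End one_measure.

Section charge_on_compact.
Variables (lam : set 'rV[R]_n -> R) (lamP : scalar_local_measure lam).
Variables (K : set 'rV[R]_n) (cK : compact K) (KO : K `<=` O).

(** The restriction of lam to a compact set is a finite signed measure on the
    whole space, to which the Hahn decomposition applies. The proofs are
    arguments for the sake of the structure of charge. *)
Definition restricted_charge (_ : scalar_local_measure lam) (_ : compact K)
  (_ : K `<=` O) (E : set 'rV[R]_n) : \bar R := (lam (E `&` K))%:E.

Local Notation nu := (restricted_charge lamP cK KO).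

Let rK A : measurable A -> rel_compact O (A `&` K).
Proof.
move=> mA; apply: (rel_compactS (rel_compact_compact cK KO)) => //.
by apply: measurableI => //; exact: compact_measurable_rV.
Qed.

Let nu0 : nu set0 = 0%E.
Proof. by rewrite /restricted_charge set0I (slm0 lamP). Qed.

Let nu_fin A : measurable A -> nu A \is a fin_num.
Proof. by []. Qed.

Let nu_sigma_additive : semi_sigma_additive nu.
Proof.
move=> F mF tF mU.
rewrite /restricted_charge setI_bigcupl.
rewrite (_ : (fun _ => _) = EFin \o (fun N => \sum_(j < N) lam (F j `&` K))); last first.
  by apply/funext => N /=; rewrite sumEFin big_mkord.
apply: cvg_EFin; first by near=> N.
apply: lamP.
- by move=> j; exact: rK.
- exact: trivIset_setIr.
- by rewrite -setI_bigcupl; exact: rK.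
Unshelve. all: by end_near. Qed.

HB.instance Definition _ := isCharge.Build _ _ _ nu nu0 nu_fin nu_sigma_additive.

(** The maximum is attained on the positive part of K in a Hahn
    decomposition. *)
Lemma slm_bounded : exists M, forall E, measurable E -> E `<=` K -> lam E <= M.
Proof.
have [P [N [[mP Pge] [mN Nle] PNT PN0]]] := Hahn_decomposition nu.
exists (lam (P `&` K)) => E mE EK.
have sub0 A : measurable A -> A `<=` P -> 0 <= lam (A `&` K).
  by move=> mA /(Pge _ mA); rewrite lee_fin.
have sub1 A : measurable A -> A `<=` N -> lam (A `&` K) <= 0.
  by move=> mA /(Nle _ mA); rewrite lee_fin.
have PK := rK mP.
have rE : rel_compact O E by rewrite -(setIidl EK); exact: rK.
rewrite (slm_split lamP rE mP) (slm_split lamP PK mE).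
have -> : E `&` P = P `&` K `&` E by rewrite -setIA (setIidr EK) setIC.
rewrite lerD2l (@le_trans _ _ 0)//.
- rewrite -(setIidl (_ : E `\` P `<=` K)); last by move=> x [/EK].
  apply: sub1; first exact: measurableD.
  move=> x [_ Px]; have : (P `|` N) x by rewrite PNT.
  by case.
- rewrite (_ : P `&` K `\` E = (P `\` E) `&` K); last first.
    by rewrite !setDE setIAC.
  by apply: sub0; [exact: measurableD|exact: subDsetl].
Qed.

End charge_on_compact.

Section positive_variation_measure.
Variables (lam : set 'rV[R]_n -> R) (lamP : scalar_local_measure lam).
Local Open Scope ereal_scope.

(** The positive variation is a measure only because lam is additive: the
    alias takes the proof as an argument so that the structure of measure can
    be attached to it. *)
Definition posvar (_ : scalar_local_measure lam) : set 'rV[R]_n -> \bar R :=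
  positive_variation O lam.

Local Notation pv := (posvar lamP).

Let pv_ub B E : rel_compact O E -> E `<=` B -> (lam E)%:E <= pv B.
Proof. by move=> rE EB; apply: ereal_sup_ubound; exists E. Qed.

Let pv_ge0 B : 0 <= pv B.
Proof.
by have := pv_ub (@rel_compact0 R n O) (@sub0set _ B); rewrite (slm0 lamP).
Qed.

Let pv0 : pv set0 = 0.
Proof.
apply/eqP; rewrite eq_le pv_ge0 andbT.
apply: ge_ereal_sup => _ [E [_ +]] <-; rewrite subset0 => ->.
by rewrite (slm0 lamP).
Qed.

Let pv_le A B : A `<=` B -> pv A <= pv B.
Proof.
move=> AB; apply: ge_ereal_sup => _ [E [rE EA]] <-.
by apply: pv_ub => //; exact: subset_trans AB.
Qed.

Let pv_superadd A B : A `&` B = set0 -> pv A + pv B <= pv (A `|` B).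
Proof.
move=> AB.
have [->|] := eqVneq (pv (A `|` B)) +oo; first by rewrite leey.
rewrite -ltey => ABoo.
have ABfin : pv (A `|` B) \is a fin_num by rewrite ge0_fin_numE.
have Afin : pv A \is a fin_num.
  by rewrite ge0_fin_numE// (le_lt_trans _ ABoo)// pv_le//; exact: subsetUl.
rewrite addeC -leeBrDr//; apply: ge_ereal_sup => _ [E [rE EB]] <-.
rewrite leeBrDr// addeC -leeBrDr//; apply: ge_ereal_sup => _ [E' [rE' E'A]] <-.
rewrite leeBrDr// -EFinD -(slmU lamP)//.
  by apply: pv_ub; [exact: rel_compactU|exact: setUSS].
by apply/seteqP; split => // x [/E'A Ax /EB Bx]; rewrite -AB.
Qed.

Let pv_sigma_additive : semi_sigma_additive pv.
Proof.
move=> F mF tF mU.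
suff -> : pv (\bigcup_k F k) = \sum_(k <oo) pv (F k).
  by apply: is_cvg_nneseries => k _ _; exact: pv_ge0.
apply/eqP; rewrite eq_le; apply/andP; split; last first.
  apply: lime_le; first by apply: is_cvg_nneseries => k _ _; exact: pv_ge0.
  apply: nearW => N; rewrite big_mkord.
  apply: (@le_trans _ _ (pv (\big[setU/set0]_(k < N) F k))); last first.
    by apply: pv_le; exact: bigsetU_bigcup.
  elim: N => [|N IH]; first by rewrite !big_ord0 pv0.
  rewrite !big_ord_recr/=; apply: le_trans (pv_superadd _).
    exact: leeD.
  apply/seteqP; split => // x []; rewrite -bigcup_mkord => -[k /= kN Fkx FNx].
  have := tF k N I I; move=> /(_ (ex_intro _ x (conj Fkx FNx))) kNE.
  by move: kN; rewrite kNE ltnn.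
apply: ge_ereal_sup => _ [E [rE EU]] <-.
have rEF k : rel_compact O (E `&` F k).
  by apply: (rel_compactS rE) => //; apply: measurableI => //; exact: rE.1.
have EE : E = \bigcup_k (E `&` F k) by rewrite -setI_bigcupr; apply/esym/setIidl.
have h : (fun N => \sum_(k < N) lam (E `&` F k))%R @ \oo --> lam E.
  rewrite {2}EE; apply: lamP => //; last by rewrite -EE.
  exact: trivIset_setIl.
have h' : (fun N => (\sum_(k < N) lam (E `&` F k))%:E) @ \oo --> (lam E)%:E.
  by apply: cvg_EFin => //; near=> N.
rewrite -(cvg_lim _ h')//; apply: lime_le.
  by apply/cvg_ex; exists (lam E)%:E.
apply: nearW => N; rewrite -sumEFin.
apply: le_trans (nneseries_lim_ge N (fun k _ _ => pv_ge0 (F k))).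
by rewrite big_mkord; apply: lee_sum => k _; apply: pv_ub.
Unshelve. all: by end_near. Qed.

HB.instance Definition _ := isMeasure.Build _ _ _ pv pv0 pv_ge0 pv_sigma_additive.

Lemma posvar_lty B : rel_compact O B -> pv B < +oo.
Proof.
move=> [mB [K [cK KO BK]]]; have [M hM] := slm_bounded lamP cK KO.
apply: (@le_lt_trans _ _ M%:E); last exact: ltry.
apply: ge_ereal_sup => _ [E [[mE _] EB]] <-; rewrite lee_fin; apply: hM => //.
exact: subset_trans BK.
Qed.

Lemma posvar_ge B E : rel_compact O E -> E `<=` B -> (lam E)%:E <= pv B.
Proof. exact: pv_ub. Qed.

End positive_variation_measure.

(** For E inside B, lam E = lam B - lam (B \ E); taking suprema over E gives
    both inequalities, the variations being finite on B. *)
Lemma jordan_posvar (lam : set 'rV[R]_n -> R) (lamP : scalar_local_measure lam)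
    (lamN := scalar_local_measureN lamP) B :
  rel_compact O B -> ((lam B)%:E = posvar lamP B - posvar lamN B)%E.
Proof.
move=> rB.
have pf : posvar lamP B \is a fin_num by rewrite ge0_fin_numE ?measure_ge0// posvar_lty.
have nf : posvar lamN B \is a fin_num by rewrite ge0_fin_numE ?measure_ge0// posvar_lty.
have sp E : rel_compact O E -> E `<=` B -> lam B = lam E + lam (B `\` E).
  by move=> rE EB; rewrite (slm_split lamP rB rE.1) (setIidr EB).
have rD E : rel_compact O E -> rel_compact O (B `\` E).
  move=> rE; apply: (rel_compactS rB) => //.
  by apply: measurableD; [exact: rB.1|exact: rE.1].
apply/eqP; rewrite eq_le; apply/andP; split.
- rewrite leeBrDr// addeC -leeBrDr//; apply: ge_ereal_sup => _ [E [rE EB]] <-.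
  rewrite leeBrDr// -EFinD (sp E rE EB) addrA addNr add0r.
  by apply: posvar_ge; [exact: rD|exact: subDsetl].
- rewrite leeBlDr//; apply: ge_ereal_sup => _ [E [rE EB]] <-.
  rewrite (sp E rE EB) -leeBlDl// -EFinB opprD addrA subrr add0r.
  by apply: (posvar_ge lamN); [exact: rD|exact: subDsetl].
Qed.

End scalar_local_measure.

(** * Cut-offs adapted to a cover by balls *)

Section covers.
Context {R : realType} {n : nat}.

Implicit Types K O : set 'rV[R]_n.

(** A finite family of balls is a list of pairs (centre, radius); a dilates
    the radii. *)
Definition balls (a : R) (s : seq ('rV[R]_n * R)) : set 'rV[R]_n :=
  [set y | exists2 p, p \in s & ball p.1 (a * p.2) y].

(** C depends on the dimension only: the gradient bound of the cut-off is a
    sum over the balls of the cover, with no constant counting overlaps. *)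
Definition bump_constant (C : R) := forall s : seq ('rV[R]_n * R),
  (forall p, p \in s -> 0 < p.2) ->
  exists phi : 'rV[R]_n -> R,
    [/\ forall k, Ck k setT phi,
        forall y, 0 <= phi y <= 1,
        forall y, balls 1 s y -> phi y = 1,
        forall y, ~ balls n.+1%:R s y -> phi y = 0 &
        forall y i, `|'D_'e_i phi y| <=
          \sum_(p <- s) C / p.2 * \1_(ball p.1 (n.+1%:R * p.2)) y].

(** The cut-off is 1 - prod (1 - phi_p), built ball by ball: for
    phi = 1 - (1 - f) (1 - g) the product rule gives
    D phi = (1 - f) Dg + (1 - g) Df, and the factors 1 - f and 1 - g are at
    most 1. Unlike a maximum, this keeps phi smooth. *)
Lemma exists_bump_constant : exists2 C, 0 <= C & bump_constant C.
Proof.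
have [C C0 hC] := @smooth_bump R n.
exists C => //; elim => [|[x r] s IH] s0.
  exists (cst 0); split => //.
  - by move=> k; exact: Ck_cst.
  - by move=> y; rewrite lexx ler01.
  - by move=> y [].
  - by move=> y i; rewrite big_nil derive_cst normr0.
have r0 : 0 < r by apply: (s0 (x, r)); rewrite mem_head.
have [|f [fS f01 f1 f0 fD]] := IH.
  by move=> p ps; apply: s0; rewrite in_cons ps orbT.
have [g [gS g01 g1 g0 gD]] := hC x r r0.
pose phi := g + cst (-1) * (f * g) + f.
have phiE y : phi y = g y + (-1) * (f y * g y) + f y by [].
have df y i : derivable f y 'e_i by have [_ /(_ i)[/(_ y I)]] := fS 1%N.
have dg y i : derivable g y 'e_i by have [_ /(_ i)[/(_ y I)]] := gS 1%N.
exists phi; split.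
- move=> k; apply: CkD => //; apply: CkD => //; apply: CkM; first exact: Ck_cst.
  exact: CkM.
- move=> y; rewrite phiE; have /andP[] := f01 y; have /andP[] := g01 y; nra.
- move=> y [p]; rewrite in_cons phiE => /orP[/eqP -> /=|ps yp].
    by rewrite mul1r => /g1 ->; lra.
  by rewrite (f1 y); [lra|exists p].
- move=> y ny; rewrite phiE f0 ?g0.
  + by lra.
  + by move=> h; apply: ny; exists (x, r) => //; rewrite mem_head.
  + by move=> [p ps yp]; apply: ny; exists p => //; rewrite in_cons ps orbT.
- move=> y i; rewrite big_cons /=.
  have dfg := derivableM (df y i) (dg y i).
  have dc := @derivable_cst _ _ R^o (-1 : R) y 'e_i.
  have -> : 'D_'e_i phi y = (1 - f y) * 'D_'e_i g y + (1 - g y) * 'D_'e_i f y.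
    rewrite /phi (deriveD (derivableD (dg y i) (derivableM dc dfg)) (df y i)).
    rewrite (deriveD (dg y i) (derivableM dc dfg)) (deriveM dc dfg) derive_cst scaler0.
    by rewrite (deriveM (df y i) (dg y i)) /GRing.scale/=; ring.
  apply: (le_trans (ler_normD _ _)); apply: lerD.
    rewrite normrM; apply: (le_trans _ (gD y i)).
    rewrite ler_piMl// ger0_norm; have /andP[] := f01 y; lra.
  rewrite normrM; apply: (le_trans _ (fD y i)).
  rewrite ler_piMl// ger0_norm; have /andP[] := g01 y; lra.
Qed.

Definition nbhd_of (K : set 'rV[R]_n) r := \bigcup_(x in K) ball x r.

Lemma open_nbhd_of K r : open (nbhd_of K r).
Proof. by apply: bigcup_open => x _; exact: ball_open. Qed.

Lemma nbhd_ofS K r s : r <= s -> nbhd_of K r `<=` nbhd_of K s.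
Proof. by move=> rs y [x Kx xy]; exists x => //; exact: le_ball xy. Qed.

Lemma sub_nbhd_of K r : 0 < r -> K `<=` nbhd_of K r.
Proof. by move=> r0 x Kx; exists x => //; exact: ballxx. Qed.

Lemma bigcap_nbhd_of K d : 0 < d -> closed K ->
  \bigcap_k nbhd_of K (d / k.+1%:R) = K.
Proof.
move=> d0 cK; apply/seteqP; split => x; last first.
  by move=> Kx k _; apply: sub_nbhd_of => //; rewrite divr_gt0.
move=> Kx; apply: cK => B /nbhs_ballP[e /= e0 eB].
have ed0 : 0 < e / d by rewrite divr_gt0.
have [k _ /(_ k (leqnn _)) /= kP] := near_infty_natSinv_lt (PosNum ed0).
have [y Ky yx] := Kx k I; exists y; split => //; apply: eB.
apply: ball_sym; apply: le_ball yx; apply: ltW.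
by rewrite mulrC -ltr_pdivlMr.
Qed.

(** The finite subcover of an increasing cover is its largest member. *)
Lemma compact_increasing_cover (K : set 'rV[R]_n) (V : (set 'rV[R]_n)^nat) :
  compact K -> (forall k, open (V k)) -> {homo V : k m / (k <= m)%N >-> k `<=` m} ->
  K `<=` \bigcup_k V k -> exists N, K `<=` V N.
Proof.
rewrite compact_cover => cK oV ndV KV.
have [k _|D _ KD] := cK nat setT V _ KV; first exact: oV.
exists (\max_(k <- finmap.enum_fset D) k)%N => x /KD[k kD]; apply: ndV.
exact: (@leq_bigmax_seq _ _ xpredT id).
Qed.

Lemma compact_erosion K O : compact K -> open O -> K `<=` O ->
  exists2 d, 0 < d & K `<=` erosion O d.
Proof.
move=> cK oO KO.
have inv0 k : 0 < k.+1%:R^-1 :> R by rewrite invr_gt0.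
have [N KN] : exists N, K `<=` (erosion O N.+1%:R^-1)^°.
  apply: compact_increasing_cover => //.
  - by move=> k; exact: open_interior.
  - move=> k l kl; apply: interiorS; apply: erosion_le.
    by rewrite lef_pV2 ?posrE// ler_nat.
  - move=> x Kx; have [k /(_ k (leqnn _)) kx] := open_erosion oO (KO x Kx).
    exists k.*2.+1 => //; apply/nbhs_ballP.
    exists (k.*2.+2%:R^-1) => //= y xy z yz.
    apply: kx; apply: le_ball (ball_triangle xy yz).
    by rewrite -doubleS -muln2 natrM invfM -splitr.
by exists N.+1%:R^-1 => // x /KN /interior_subset.
Qed.

Lemma compact_neighbourhood K O : compact K -> open O -> K `<=` O ->
  exists d L, [/\ 0 < d, compact L, L `<=` O & nbhd_of K d `<=` L].
Proof.
move=> cK oO KO; have [d d0 Kd] := compact_erosion cK oO KO.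
have d20 : 0 < d / 2 by rewrite divr_gt0.
exists (d / 2), (closure (nbhd_of K (d / 2))); split => //; last exact: subset_closure.
- have [M M0 KM] := compact_sub_ball cK.
  apply: bounded_closed_compact; last exact: closed_closure.
  exists (M + d); split; first by rewrite num_real.
  move=> t tM y /(_ (ball y (d / 2)) (nbhsx_ballx _ _ d20))[z [[x Kx xz] yz]].
  have := ball_triangle (ball_triangle (KM x Kx) xz) (ball_sym yz).
  by rewrite -ball_normE /ball_/= sub0r normrN; lra.
- move=> y /(_ (ball y (d / 2)) (nbhsx_ballx _ _ d20))[z [[x Kx xz] yz]].
  by apply: (Kd x Kx); have := ball_triangle xz (ball_sym yz); rewrite -splitr.
Qed.

End covers.

(** * The divergence measure of a compact set *)

Lemma integral_support d (T : measurableType d) (R : realType)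
    (mu : {measure set T -> \bar R}) (D L : set T) (f : T -> \bar R) :
  L `<=` D -> (forall x, ~ L x -> f x = 0%E) ->
  (\int[mu]_(x in D) f x = \int[mu]_(x in L) f x)%E.
Proof.
move=> LD f0; rewrite [LHS]integral_mkcond [RHS]integral_mkcond.
apply: eq_integral => x _; rewrite /patch.
have [xL|xL] := boolP (x \in L).
  by rewrite ifT// inE; apply: LD; rewrite inE in xL.
by rewrite f0 ?if_same//; move: xL; rewrite notin_setE.
Qed.

Section gradient_bound.
Context {R : realType} {n : nat}.
Local Notation mu := (lebesgue_rV n).

(** Since the integral of D_i phi vanishes, a constant c may be subtracted
    from g at no cost: the oscillation of g, and not g itself, bounds the
    integral. *)
Lemma integral_gradient_le (phi g : 'rV[R]_n -> R) (i : 'I_n) (O L : set 'rV[R]_n)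
    (c : R) (s : seq ('rV[R]_n * R)) (C a : R) (M : 'rV[R]_n * R -> R) :
  (forall k, Ck k setT phi) -> compact L -> L `<=` O ->
  (forall y, ~ L y -> phi y = 0) ->
  (forall y, `|'D_'e_i phi y| <=
     \sum_(p <- s) C / p.2 * \1_(ball p.1 (a * p.2)) y) ->
  0 <= C ->
  (forall p, p \in s -> 0 < p.2 /\ ball p.1 (a * p.2) `<=` L) ->
  measurable_fun O g -> measurable O -> (\int[mu]_(x in L) `|g x|%:E < +oo)%E ->
  (forall p, p \in s ->
     (\int[mu]_(x in ball p.1 (a * p.2)) `|g x - c|%:E <= (M p)%:E)%E) ->
  (`|\int[mu]_(x in O) ('D_'e_i phi x * g x)%:E|
     <= (\sum_(p <- s) C / p.2 * M p)%:E)%E.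
Proof.
move=> phiS cL LO phi0 Dle C0 sL mg mO ig gM.
have mL := compact_measurable_rV cL.
have [cphi /(_ i)[dphi [cD _]]] := phiS 1%N.
have {}cD : continuous ('D_'e_i phi) by move=> x; exact: cD.
have {}dphi x : derivable phi x 'e_i by exact: dphi.
set D := 'D_'e_i phi.
have D0 y : ~ L y -> D y = 0.
  by apply: derive_eq0_outside => //; exact: compact_closed_rV.
have mD A : measurable_fun A D.
  by apply: measurable_funTS; exact: continuous_measurable_rV.
have mgL : measurable_fun L g by exact: measurable_funS mg.
have igL : mu.-integrable L (EFin \o g).
  by apply/integrableP; split => //; exact/measurable_EFinP.
have [B B0 DB] := continuous_compact_bounded cD cL.
have iDL : mu.-integrable L (EFin \o D).
  by apply: (@integrable_bounded _ _ _ _ B) => //; exact: compact_lebesgue.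
have icL : mu.-integrable L (EFin \o cst c).
  by apply: (@integrable_bounded _ _ _ _ `|c|) => //; exact: compact_lebesgue.
have igcL : mu.-integrable L (fun x => (g x - c)%:E).
  exact: (integrableB mL igL icL).
have mgcL : measurable_fun L (fun x => g x - c).
  by apply: measurable_funB => //; exact: measurable_cst.
have iDgL : mu.-integrable L (fun x => (D x * (g x - c))%:E).
  apply: (@le_integrable _ _ _ _ _ mL _ (fun x => B%:E * (g x - c)%:E)%E).
  - by apply/measurable_EFinP; apply: measurable_funM.
  - move=> x Lx; rewrite -EFinM !abse_EFin lee_fin !normrM; apply: ler_wpM2r => //.
    by rewrite (le_trans (DB _ Lx))// ler_norm.
  - exact: integrableZl.
rewrite (@integral_support _ _ _ mu O L)//; last first.
  by move=> x /D0 Dx; change (EFin (D x * g x) = 0%E); rewrite Dx mul0r.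
have -> : (\int[mu]_(x in L) (D x * g x)%:E =
    \int[mu]_(x in L) (D x * (g x - c))%:E)%E.
  rewrite (eq_integral (fun x => (D x * (g x - c))%:E + c%:E * (D x)%:E)%E); last first.
    by move=> x _; rewrite -EFinM -EFinD; congr EFin; ring.
  rewrite integralD//; last exact: integrableZl.
  rewrite integralZl//.
  have <- : (\int[mu]_x (D x)%:E = \int[mu]_(x in L) (D x)%:E)%E.
    by apply: integral_support => // x /D0 ->.
  by rewrite (@integral_partial_eq0 R n phi i L)// mule0 adde0.
apply: le_trans (le_abse_integral _ mL _) _.
  exact: measurable_int iDgL.
pose h (p : 'rV[R]_n * R) x :=
  ((C / `|p.2|)%:E * ((\1_(ball p.1 (a * p.2)) x)%:E * `|g x - c|%:E))%E.
have mi p : measurable_fun L (fun x => ((\1_(ball p.1 (a * p.2)) x)%:E * `|g x - c|%:E)%E).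
  apply/measurable_EFinP; apply: measurable_funM.
    by apply: measurable_indic; exact: measurable_ball_rV.
  exact: measurableT_comp.
have mh p : measurable_fun L (h p) by apply: measurable_funeM; exact: mi.
have h0 p x : L x -> (0 <= h p x)%E.
  by move=> _; rewrite /h -!EFinM lee_fin !mulr_ge0.
apply: (@le_trans _ _ (\int[mu]_(x in L) \sum_(p <- s) h p x)%E).
  apply: ge0_le_integral => //.
  - by apply: measurableT_comp => //; exact: measurable_int iDgL.
  - exact: emeasurable_sum.
  - move=> x Lx; rewrite abse_EFin normrM.
    rewrite [leRHS](_ : _ = ((\sum_(p <- s) C / p.2 * \1_(ball p.1 (a * p.2)) x)
                             * `|g x - c|)%:E).
      by rewrite lee_fin; apply: ler_wpM2r => //; exact: Dle.
    rewrite mulr_suml -sumEFin big_seq [RHS]big_seq; apply: eq_bigr => p ps.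
    have [p0 _] := sL p ps.
    by rewrite /h (gtr0_norm p0) -!EFinM mulrA.
rewrite ge0_integral_sum// -sumEFin big_seq [leRHS]big_seq; apply: lee_sum => p ps.
have [p0 pL] := sL p ps.
rewrite /h (ge0_integralZl mu mL (mi p)); last 2 first.
- by move=> x _; rewrite -EFinM lee_fin mulr_ge0.
- by rewrite lee_fin divr_ge0.
rewrite (gtr0_norm p0) [leRHS]EFinM; apply: lee_wpmul2l.
  by rewrite lee_fin divr_ge0// ltW.
rewrite (eq_integral ((fun x => `|g x - c|%:E) \_ (ball p.1 (a * p.2)))); last first.
  move=> x _; rewrite /patch indicE; case: ifPn => _; first by rewrite mul1e.
  by rewrite mul0e.
by rewrite -integral_mkcondr (setIidr pL); exact: gM.
Qed.

End gradient_bound.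

Section divergence.
Context {R : realType} {n : nat} (O : set 'rV[R]_n).
Variables (lam : set 'rV[R]_n -> R) (lamP : scalar_local_measure O lam).
Local Notation mu := (lebesgue_rV n).
Let lamN := scalar_local_measureN lamP.

(** Because phi lies between the indicators of K and of N. *)
Lemma integral_posvar_squeeze (l : set 'rV[R]_n -> R) (lP : scalar_local_measure O l)
    (K N : set 'rV[R]_n) (phi : 'rV[R]_n -> R) e :
  measurable K -> measurable N -> K `<=` O -> N `<=` O -> measurable O ->
  measurable_fun setT phi -> (forall x, 0 <= phi x <= 1) ->
  (forall x, K x -> phi x = 1) -> (forall x, ~ N x -> phi x = 0) ->
  (posvar lP N < posvar lP K + e%:E)%E ->
  (posvar lP K <= \int[posvar lP]_(x in O) (phi x)%:E <= posvar lP K + e%:E)%E.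
Proof.
move=> mK mN KO NO mO mphi phi01 phi1 phi0 Ne.
have mf (D : set 'rV[R]_n) : measurable_fun D (fun x => (phi x)%:E).
  by apply/measurable_EFinP; exact: measurable_funTS.
have mi (D A : set 'rV[R]_n) : measurable A -> measurable_fun D (fun x => (\1_A x : R)%:E).
  by move=> mA; apply/measurable_EFinP; exact: measurable_indic.
apply/andP; split.
  rewrite -{1}(setIidl KO) -(integral_indic (posvar lP) mO mK).
  apply: ge0_le_integral => //.
  - exact: mi.
  - move=> x _; rewrite lee_fin indicE; have [xK|xK] := boolP (x \in K).
      by rewrite phi1//; rewrite inE in xK.
    by have /andP[] := phi01 x.
apply/ltW; apply: le_lt_trans Ne.
rewrite -(setIidl NO) -(integral_indic (posvar lP) mO mN).
apply: ge0_le_integral => //.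
- by move=> x _; rewrite lee_fin; have /andP[] := phi01 x.
- exact: mi.
- move=> x _; rewrite lee_fin indicE; have [xN|] := boolP (x \in N).
    by have /andP[] := phi01 x.
  by rewrite notin_setE => /phi0 ->.
Qed.

Variable f : 'I_n -> 'rV[R]_n -> R.
Hypothesis oO : open O.
Hypothesis mf : forall i, measurable_fun O (f i).
Hypothesis intf : forall i K, compact K -> K `<=` O ->
  (\int[mu]_(x in K) `|f i x|%:E < +oo)%E.
Hypothesis divf : forall phi, test_function O phi ->
  (\int[posvar lamP]_(x in O) (phi x)%:E - \int[posvar lamN]_(x in O) (phi x)%:E =
   - \sum_i \int[mu]_(x in O) ('D_'e_i phi x * f i x)%:E)%E.

(** Test the divergence with the cut-off of a cover of K by balls so small that
    the cut-off lives in a neighbourhood of K with almost the mass of K, for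
    both variations: the left-hand side is lam K up to eta, and the right-hand
    side is bounded by integral_gradient_le on each ball. Each term of the sum
    is of order eps times the (n-1)-st power of the radius. *)
Lemma divergence_compact_le C (K : set 'rV[R]_n) (c : 'rV[R]_n) rho eps :
  bump_constant (n := n) C -> 0 <= C -> compact K -> K `<=` O -> 0 < rho ->
  (forall x r i, K x -> 0 < r < rho ->
     (\int[mu]_(y in ball x r) `|f i y - c ord0 i|%:E <= (eps * r ^+ n)%:E)%E) ->
  forall eta, 0 < eta -> exists2 delta, 0 < delta &
    forall s : seq ('rV[R]_n * R),
      (forall p, p \in s -> K p.1 /\ 0 < p.2 < delta) -> K `<=` balls 1 s ->
      `|lam K| <= n%:R * (\sum_(p <- s) C / p.2 * (eps * (n.+1%:R * p.2) ^+ n)) + eta.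
Proof.
move=> hC C0 cK KO rho0 fK eta eta0.
have [d [L [d0 cL LO KL]]] := compact_neighbourhood cK oO KO.
have mK := compact_measurable_rV cK; have mL := compact_measurable_rV cL.
have mO : measurable O by exact: open_measurable_mx.
pose Nb k := nbhd_of K (d / k.+1%:R).
have NbL k : Nb k `<=` L.
  apply: subset_trans KL; apply: nbhd_ofS.
  by rewrite ler_pdivrMr// ler_peMr ?(ltW d0)// ler1n.
have mNb k : measurable (Nb k) by apply: open_measurable_mx; exact: open_nbhd_of.
have Nbdec : {homo Nb : k m / (k <= m)%N >-> m `<=` k}.
  move=> k m km; apply: nbhd_ofS; apply: ler_wpM2l; first exact: ltW.
  by rewrite lef_pV2 ?posrE// ler_nat.
have rL : rel_compact O L by exact: rel_compact_compact.
have rK : rel_compact O K by exact: rel_compact_compact.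
have shrink (l : set 'rV[R]_n -> R) (lP : scalar_local_measure O l) :
    exists k, forall m, (k <= m)%N -> (posvar lP (Nb m) < posvar lP K + (eta / 2)%:E)%E.
  have Kfin : posvar lP K \is a fin_num.
    by rewrite ge0_fin_numE ?measure_ge0// posvar_lty.
  apply: nonincreasing_measure_lt => //.
  - by apply: posvar_lty; exact: rel_compactS rL (mNb _) (NbL _).
  - rewrite bigcap_nbhd_of//; last exact: compact_closed_rV.
    by rewrite lte_spaddre// lte_fin divr_gt0.
have [k1 hk1] := shrink _ lamP; have [k2 hk2] := shrink _ lamN.
pose k := maxn k1 k2.
pose b : R := n.+1%:R.
have b0 : 0 < b by rewrite ltr0n.
(* The balls dilated by b must fit into Nb k and into the scale rho. *)
exists (Num.min (d / k.+1%:R) rho / b).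
  by rewrite divr_gt0// lt_min rho0 andbT divr_gt0.
move=> s sK Ks.
have s0 p : p \in s -> 0 < p.2 by move=> /sK[_ /andP[]].
have sN p : p \in s -> ball p.1 (b * p.2) `<=` Nb k.
  move=> /sK[Kp /andP[_ pd]] y py; exists p.1 => //; apply: le_ball py.
  by move: pd; rewrite ltr_pdivlMr// mulrC lt_min => /andP[/ltW].
have srho p : p \in s -> 0 < b * p.2 < rho.
  move=> ps; rewrite mulr_gt0 ?s0//=.
  by have [_ /andP[_]] := sK p ps; rewrite ltr_pdivlMr// mulrC lt_min => /andP[].
have [phi [phiS phi01 phi1 phi0 phiD]] := hC s s0.
have phiN y : ~ Nb k y -> phi y = 0.
  by move=> Ny; apply: phi0 => -[p ps py]; apply: Ny; exact: sN py.
have phiL y : ~ L y -> phi y = 0 by move=> Ly; apply: phiN => /NbL.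
have tphi : test_function O phi by split => //; exists L.
have cphi : continuous phi by move=> x; have [h _] := phiS 0%N; exact: h.
have mphi : measurable_fun setT phi by exact: continuous_measurable_rV.
have phiK y : K y -> phi y = 1 by move=> /Ks /phi1.
have NbO : Nb k `<=` O by move=> y /NbL /LO.
have := integral_posvar_squeeze mK (mNb k) KO NbO mO mphi phi01 phiK phiN
  (hk1 k (leq_maxl _ _)).
have := integral_posvar_squeeze mK (mNb k) KO NbO mO mphi phi01 phiK phiN
  (hk2 k (leq_maxr _ _)).
have := jordan_posvar lamP rK; rewrite -/lamN.
have pfin (l : set 'rV[R]_n -> R) (lP : scalar_local_measure O l) :
    posvar lP K = (fine (posvar lP K))%:E.
  by rewrite fineK// ge0_fin_numE ?measure_ge0// posvar_lty.
rewrite (pfin _ lamP) (pfin _ lamN).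
have Ile i : (`|\int[mu]_(x in O) ('D_'e_i phi x * f i x)%:E| <=
    (\sum_(p <- s) C / p.2 * (eps * (b * p.2) ^+ n))%:E)%E.
  apply: (integral_gradient_le (L := L) (c := c ord0 i) (a := b)) => //.
  - by move=> p ps; split; [exact: s0|apply: subset_trans (NbL k); exact: sN].
  - exact: intf.
  - by move=> p ps; apply: fK; [have [] := sK p ps|exact: srho].
have Ifin i : exists r,
    (\int[mu]_(x in O) ('D_'e_i phi x * f i x)%:E)%E = r%:E /\
    `|r| <= \sum_(p <- s) C / p.2 * (eps * (b * p.2) ^+ n).
  move: (Ile i); case: (\int[mu]_(x in O) _)%E => [r| |] //= h; exists r; split => //.
have /choice[I hI] := Ifin.
have := divf tphi.
under eq_bigr do rewrite (hI _).1.
rewrite sumEFin -EFinN.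
move: (fine (posvar lamP K)) (fine (posvar lamN K)) => a1 a2.
case: (\int[posvar lamP]_(x in O) _)%E => [i1| |] //=;
case: (\int[posvar lamN]_(x in O) _)%E => [i2| |] //=.
rewrite -!EFinD !lee_fin => -[e1] [e2] /andP[i2a i2b] /andP[i1a i1b].
have Sle : `|\sum_i I i| <= n%:R * (\sum_(p <- s) C / p.2 * (eps * (b * p.2) ^+ n)).
  apply: le_trans (ler_norm_sum _ _ _) _.
  apply: (le_trans (ler_sum _ (fun i _ => (hI i).2))).
  by rewrite sumr_const card_ord mulr_natl.
move: Sle; set S := \sum_i I i in e1 *; set B := n%:R * _.
rewrite e2 !ler_norml => /andP[S1 S2]; apply/andP; split; lra.
Qed.

End divergence.

(** * Null sets of the divergence measure *)

Lemma exists_common_lower_bound (R : realType) (d : nat -> R) N :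
  (forall i, 0 < d i) -> exists2 e, 0 < e & forall i, (i < N)%N -> e <= d i.
Proof.
move=> d0; elim: N => [|N [e e0 IH]]; first by exists 1.
exists (Num.min e (d N)); first by rewrite lt_min e0 d0.
move=> i; rewrite ltnS leq_eqVlt => /orP[/eqP ->|iN].
  by rewrite ge_min lexx orbT.
by rewrite ge_min IH.
Qed.

Section approximation.
Context {R : realType} {n : nat}.

(** Finitely many of the pieces F j carry almost all the mass of E, and each
    of these is almost exhausted by a compact set. *)
Lemma finite_compact_approximation (nu : {measure set 'rV[R]_n -> \bar R})
    (L E : set 'rV[R]_n) (F : (set 'rV[R]_n)^nat) :
  compact L -> (nu L < +oo)%E -> measurable E -> E `<=` L ->
  (forall j, measurable (F j)) -> E `<=` \bigcup_j F j ->
  (forall j, F j `<=` E) ->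
  forall e, 0 < e -> exists N (K : (set 'rV[R]_n)^nat),
    (forall j, compact (K j) /\ K j `<=` F j) /\
    (nu (E `\` \big[setU/set0]_(j < N) K j) < e%:E)%E.
Proof.
move=> cL Loo mE EL mF EF FE e e0.
have mL := compact_measurable_rV cL.
have Eoo : (nu E < +oo)%E.
  by apply: le_lt_trans Loo; apply: le_measure; rewrite ?inE.
have e20 : 0 < e / 2 by rewrite divr_gt0.
pose D N := E `\` \big[setU/set0]_(j < N) F j.
have mU N : measurable (\big[setU/set0]_(j < N) F j) by exact: bigsetU_measurable.
have mD N : measurable (D N) by exact: measurableD.
have [||| |N /(_ N (leqnn _)) DN] := @nonincreasing_measure_lt _ _ _ nu D (e / 2)%:E.
- by rewrite /D big_ord0 setD0.
- exact: mD.
- by move=> k m km; apply: setDS; exact: subset_bigsetU.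
- rewrite (_ : \bigcap_i D i = set0) ?measure0 ?lte_fin//.
  apply/seteqP; split => // x Dx; have [Ex _] := Dx 0 I.
  have [j _ Fjx] := EF x Ex; have [_] := Dx j.+1 I; apply.
  by rewrite -bigcup_mkord; exists j => //=.
pose a := e / 2 / N.+1%:R.
have a0 : 0 < a by rewrite divr_gt0.
have /choice[K hK] : forall j, exists C, [/\ compact C, C `<=` F j & (nu (F j `\` C) < a%:E)%E].
  by move=> j; apply: (@compact_inner_regularity R n nu L) => //; exact: subset_trans EL.
exists N, K; split; first by move=> j; have [? ? _] := hK j.
have mK j : measurable (K j) by apply: compact_measurable_rV; have [] := hK j.
have mFK j : measurable (F j `\` K j) by exact: measurableD.
have mUF : measurable (\big[setU/set0]_(j < N) (F j `\` K j)) by exact: bigsetU_measurable.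
apply: (@le_lt_trans _ _ (nu (D N `|` \big[setU/set0]_(j < N) (F j `\` K j)))).
  apply: le_measure; rewrite ?inE.
  - by apply: measurableD => //; exact: bigsetU_measurable.
  - exact: measurableU.
  - move=> x [Ex nKx].
    have [Fx|nFx] := pselect ((\big[setU/set0]_(j < N) F j) x); last by left; split.
    right; move: Fx; rewrite -bigcup_mkord => -[j jN Fjx].
    rewrite -(bigcup_mkord N (fun j => F j `\` K j)); exists j => //; split => // Kjx.
    by apply: nKx; rewrite -bigcup_mkord; exists j.
apply: le_lt_trans (measureU2 nu (mD N) mUF) _.
have B : (nu (\big[setU/set0]_(j < N) (F j `\` K j)) <= (e / 2)%:E)%E.
  apply: (le_trans (Boole_inequality nu (fun j _ => mFK j))).
  apply: (@le_trans _ _ (\sum_(j < N) a%:E)%E).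
    by apply: lee_sum => j _; apply: ltW; have [] := hK j.
  rewrite sumEFin sumr_const card_ord lee_fin -[leLHS]mulr_natr /a.
  rewrite -[leLHS]mulrA ler_piMr ?(ltW e20)//.
  by rewrite mulrC ler_pdivrMr// mul1r ler_nat.
rewrite [e]splitr EFinD lte_leD// ge0_fin_numE//.
by apply: (le_lt_trans B); exact: ltry.
Qed.

Lemma disjoint_compacts_separated (K : (set 'rV[R]_n)^nat) N :
  (forall j, compact (K j)) -> (forall i j, i != j -> K i `&` K j = set0) ->
  exists2 d, 0 < d & forall i j x y, (i < N)%N -> (j < N)%N -> K i x -> K j y ->
    ball x d y -> i = j.
Proof.
move=> cK Kdisj.
pose K' i j := if j == i then set0 else K j.
pose T i := \bigcup_(j < N) K' i j.
have cT i : compact (T i).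
  rewrite /T bigcup_mkord; apply: bigsetU_compact => j _; rewrite /K'.
  by case: ifP => // _; exact: compact0.
have KT i : K i `<=` ~` T i.
  move=> x Kix [j /= jN]; rewrite /K'; case: ifPn => // ji Kjx.
  by have : (K j `&` K i) x by []; rewrite Kdisj.
have /choice[d hd] : forall i, exists d, 0 < d /\ K i `<=` erosion (~` T i) d.
  move=> i; have [|d d0 Kd] := @compact_erosion R n (K i) (~` T i) (cK i) _ (KT i).
    by apply: closed_openC; exact: compact_closed_rV.
  by exists d.
have [|e e0 ed] := @exists_common_lower_bound R d N; first by move=> i; have [] := hd i.
exists e => // i j x y iN jN Kix Kjy xy; apply/eqP/negPn/negP => ij.
have [_ /(_ x Kix y)] := hd i; apply; first by apply: le_ball xy; exact: ed.
by exists j => //; rewrite /K' eq_sym (negPf ij).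
Qed.

End approximation.

Section null.
Context {R : realType} {n : nat}.

(** The (n-1)-dimensional size of U, in the only form in which it enters the
    argument. It is controlled by the Hausdorff measure, and easy to
    check directly on graphs. Restricting to compact subsets makes the covers
    finite. *)
Definition small_covers (B : R) (U : set 'rV[R]_n) :=
  forall K, compact K -> K `<=` U -> forall delta, 0 < delta ->
  exists s : seq ('rV[R]_n * R),
    [/\ forall p, p \in s -> 0 < p.2 < delta,
        K `<=` balls 1 s &
        \sum_(p <- s) p.2 ^+ n.-1 <= B].

Lemma small_coversS B U V : U `<=` V -> small_covers B V -> small_covers B U.
Proof. by move=> UV sV K cK KU; apply: sV => // x /KU /UV. Qed.

Lemma sum_at_most_one N (P : nat -> bool) (x : R) :
  0 <= x -> (forall i j, (i < N)%N -> (j < N)%N -> P i -> P j -> i = j) ->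
  \sum_(i < N | P i) x <= x.
Proof.
move=> x0 P1; have [/existsP[i Pi]|/existsPn nP] := boolP [exists i : 'I_N, P i].
  rewrite (bigD1 i)//= big1 ?addr0// => j /andP[Pj /eqP[]].
  exact/val_inj/(P1 _ _ (ltn_ord j) (ltn_ord i) Pj Pi).
by rewrite big1// => i Pi; have := nP i; rewrite Pi.
Qed.

Lemma cover_term (C eps z t : R) m : (0 < m)%N -> 0 < t ->
  C / (2 * t) * (eps * 2 ^+ m * (z * (2 * t)) ^+ m) =
  C * (z * 2) ^+ m * 2 ^+ m.-1 * eps * t ^+ m.-1.
Proof.
case: m => // m _ t0; rewrite /= !exprMn !exprS.
by field; rewrite gt_eqF.
Qed.

(** The estimate on a piece requires balls centred on it: a ball that meets K
    is contained in the ball of twice the radius around a point of K. *)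
Lemma recentre (s : seq ('rV[R]_n * R)) (K : set 'rV[R]_n) :
  (forall p, p \in s -> 0 < p.2) -> K `<=` balls 1 s ->
  exists s' : seq ('rV[R]_n * R),
    [/\ forall q, q \in s' -> K q.1 /\ exists2 p, p \in s & q.2 = 2 * p.2,
        K `<=` balls 1 s' &
        forall F : R -> R, \sum_(q <- s') F q.2 =
          \sum_(p <- s | `[< (K `&` ball p.1 p.2) !=set0 >]) F (2 * p.2)].
Proof.
move=> s0 Ks.
pose hit (p : 'rV[R]_n * R) := `[< (K `&` ball p.1 p.2) !=set0 >].
pose c (p : 'rV[R]_n * R) : 'rV[R]_n * R := (get (K `&` ball p.1 p.2), 2 * p.2).
have cP p : hit p -> (K `&` ball p.1 p.2) (c p).1.
  by move=> /asboolP hp; rewrite /c /=; case: hp => x hx; exact: (getI hx).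
exists [seq c p | p <- s & hit p]; split.
- move=> q /mapP[p]; rewrite mem_filter => /andP[hp ps] ->; split.
    by have [] := cP p hp.
  by exists p.
- move=> x Kx; have [p ps xp] := Ks x Kx; rewrite mul1r in xp.
  have hp : hit p by apply/asboolP; exists x.
  exists (c p); first by apply/mapP; exists p => //; rewrite mem_filter hp.
  have [_ pc] := cP p hp; rewrite mul1r /= mulr_natl mulr2n.
  exact: ball_triangle (ball_sym pc) xp.
- by move=> F; rewrite big_map big_filter.
Qed.

End null.

Section scalar_null.
Context {R : realType} {n : nat} (O : set 'rV[R]_n).
Variables (lam : set 'rV[R]_n -> R) (lamP : scalar_local_measure O lam).
Local Notation mu := (lebesgue_rV n).
Let lamN := scalar_local_measureN lamP.
Variable f : 'I_n -> 'rV[R]_n -> R.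
Hypothesis n0 : (0 < n)%N.
Hypothesis oO : open O.
Hypothesis mf : forall i, measurable_fun O (f i).
Hypothesis intf : forall i K, compact K -> K `<=` O ->
  (\int[mu]_(x in K) `|f i x|%:E < +oo)%E.
Hypothesis divf : forall phi, test_function O phi ->
  (\int[posvar lamP]_(x in O) (phi x)%:E - \int[posvar lamN]_(x in O) (phi x)%:E =
   - \sum_i \int[mu]_(x in O) ('D_'e_i phi x * f i x)%:E)%E.
Hypothesis lebf : forall x, O x -> exists c : 'rV[R]_n, forall eps, 0 < eps ->
  exists2 rho, 0 < rho & forall r i, 0 < r < rho ->
    (\int[mu]_(y in ball x r) `|f i y - c ord0 i|%:E <= (eps * r ^+ n)%:E)%E.

Let mO : measurable O. Proof. exact: open_measurable_mx. Qed.

Let mfc i (c : R) (A : set 'rV[R]_n) : A `<=` O ->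
  measurable_fun A (fun y => `|f i y - c|%:E).
Proof.
move=> AO; apply/measurable_EFinP; apply: measurableT_comp => //.
apply: measurable_funB; last exact: measurable_cst.
exact: measurable_funS (mf i).
Qed.

Definition good_points (c : 'rV[R]_n) rho eps : set 'rV[R]_n :=
  [set x | forall r i, 0 < r < rho ->
    (\int[mu]_(y in ball x r) `|f i y - c ord0 i|%:E <= (eps * r ^+ n)%:E)%E].

Lemma rational_good_points x eps : O x -> 0 < eps ->
  exists (c : 'rV[rat]_n) (k : nat),
    good_points (map_mx ratr c) k.+1%:R^-1 eps x.
Proof.
move=> Ox eps0; have [c hc] := lebf Ox.
have e20 : 0 < eps / 2 by rewrite divr_gt0.
have [rho rho0 hrho] := hc _ e20.
have /nbhs_ballP[d /= d0 dO] : nbhs x O by exact: open_nbhs_nbhs.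
pose t : R := eps / 2 / 2 ^+ n.
have t0 : 0 < t by rewrite divr_gt0// exprn_gt0.
have /fin_all_exists[q hq] : forall j : 'I_n, exists q : rat, ball (c ord0 j) t (ratr q).
  by move=> j; exact: rat_near.
have min0 : 0 < Num.min rho d by rewrite lt_min rho0.
have [k _ /(_ k (leqnn _)) /= hk] := near_infty_natSinv_lt (PosNum min0).
exists (\row_j q j), k => r i /andP[r0 rk].
have [rr rd] : r < rho /\ r < d.
  by have := lt_trans rk hk; rewrite lt_min => /andP[].
have BO : ball x r `<=` O.
  by move=> y xy; apply: dO; apply: le_ball xy; exact: ltW.
have mB := measurable_ball_rV x r.
have mfB a := @mfc i a _ BO.
apply: (@le_trans _ _ (\int[mu]_(y in ball x r)
    (`|f i y - c ord0 i|%:E + `|c ord0 i - ratr (q i)|%:E))%E).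
  apply: ge0_le_integral => //.
  - by apply: emeasurable_funD; [exact: mfB|exact: measurable_cst].
  - move=> y _; rewrite !mxE -EFinD lee_fin.
    by have := ler_normD (f i y - c ord0 i) (c ord0 i - ratr (q i)); rewrite addrA subrK.
rewrite ge0_integralD//.
rewrite integral_cst// [X in (_ * X)%E](_ : _ = ((2 * r) ^+ n)%:E); last exact: lebesgue_ball.
rewrite -EFinM.
have -> : eps * r ^+ n = eps / 2 * r ^+ n + t * (2 * r) ^+ n.
  rewrite exprMn /t mulrA -(mulrA _ _ (2 ^+ n)) mulVf ?mulr1; first by lra.
  by rewrite expf_neq0.
rewrite EFinD; apply: leeD; first by apply: hrho; rewrite r0.
rewrite lee_fin; apply: ler_wpM2r; first by rewrite exprn_ge0// mulr_ge0// ltW.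
exact/ltW/(hq i).
Qed.

(** Passing to the closure makes the sets of good points Borel without any
    discussion of the dependence of the averages on x; it only costs a factor
    2^n, since a ball around a limit point lies in a ball of twice the radius
    around a nearby good point. *)
Lemma closure_good_points c rho eps (K : set 'rV[R]_n) :
  0 < rho -> compact K -> K `<=` O -> K `<=` closure (good_points c rho eps) ->
  exists2 rho', 0 < rho' & K `<=` good_points c rho' (eps * 2 ^+ n).
Proof.
move=> rho0 cK KO Kcl; have [d d0 Kd] := compact_erosion cK oO KO.
exists (Num.min (rho / 2) (d / 3)); first by rewrite lt_min !divr_gt0.
move=> x Kx r i /andP[r0]; rewrite lt_min => /andP[rrho rd].
have [z [Gz xz]] := Kcl x Kx (ball x r) (nbhsx_ballx x r r0).
have BO : ball z (2 * r) `<=` O.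
  move=> y zy; apply: (Kd x Kx); apply: le_ball (ball_triangle xz zy); lra.
apply: (@le_trans _ _ (\int[mu]_(y in ball z (2 * r)) `|f i y - c ord0 i|%:E)%E).
  apply: ge0_subset_integral => //; last 1 first.
  - by move=> y xy; rewrite mulr_natl mulr2n; exact: ball_triangle (ball_sym xz) xy.
  - exact: measurable_ball_rV.
  - exact: measurable_ball_rV.
  - exact: mfc.
by rewrite -mulrA -exprMn; apply: Gz; lra.
Qed.

Let nu := measure_add (posvar lamP) (posvar lamN).

Let abs_le A : rel_compact O A -> (`|lam A|%:E <= nu A)%E.
Proof.
move=> rA; rewrite /nu measure_addE.
have pA := posvar_ge lamP rA (@subset_refl _ A).
have nA := posvar_ge lamN rA (@subset_refl _ A).
have [l0|l0] := leP 0 (lam A).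
  by rewrite ger0_norm//; apply: (le_trans pA); rewrite leeDl.
by rewrite ltr0_norm//; apply: (le_trans nA); rewrite leeDr.
Qed.

Let nu_lty A : rel_compact O A -> (nu A < +oo)%E.
Proof. by move=> rA; rewrite /nu measure_addE lte_add_pinfty// posvar_lty. Qed.

Let slm_bigsetU N (K : (set 'rV[R]_n)^nat) : (forall j, rel_compact O (K j)) ->
  trivIset setT K -> rel_compact O (\big[setU/set0]_(j < N) K j) /\
  lam (\big[setU/set0]_(j < N) K j) = \sum_(j < N) lam (K j).
Proof.
move=> rK tK; elim: N => [|N [rU IH]].
  by rewrite !big_ord0 (slm0 lamP); split => //; exact: rel_compact0.
rewrite !big_ord_recr/=; split; first exact: rel_compactU.
rewrite (slmU lamP)// ?IH//; apply/seteqP; split => // x [].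
rewrite -bigcup_mkord => -[j /= jN Kjx KNx].
have := tK j N I I (ex_intro _ x (conj Kjx KNx)) => jNE.
by move: jN; rewrite jNE ltnn.
Qed.

(** The constant c is fixed on each of the disjoint pieces K j, so each obeys
    divergence_compact_le. Distinct pieces are at positive distance; in a cover
    of their union by smaller balls each ball meets at most one piece, hence
    the bounds for the pieces add up to the bound B for the whole cover,
    however many pieces there are. *)
Let slm_null_eps E B C eps eta : bump_constant (n := n) C -> 0 <= C -> 0 <= B ->
  rel_compact O E -> small_covers B E -> 0 < eps -> 0 < eta ->
  `|lam E| <= n%:R * C * (n.+1%:R * 2) ^+ n * 2 ^+ n.-1 * B * eps + eta.
Proof.
move=> hC C0 B0 rE sE eps0 eta0.
have [mE [L [cL LO EL]]] := rE.
have rL := rel_compact_compact cL LO.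
(* Countably many pairs (c, 1/(k+1)) are enough, since c may be rational;
   indices that code no pair get a harmless default. *)
pose c (j : nat) : 'rV[R]_n :=
  if @unpickle ('rV[rat]_n * nat)%type j is Some p then map_mx ratr p.1 else 0.
pose rho (j : nat) : R :=
  if @unpickle ('rV[rat]_n * nat)%type j is Some p then p.2.+1%:R^-1 else 1.
have rho0 j : 0 < rho j by rewrite /rho; case: unpickle.
pose G j := closure (good_points (c j) (rho j) eps).
pose F j := E `&` seqDU G j.
have mG j : measurable (G j) by apply: closed_measurable_rV; exact: closed_closure.
have mF j : measurable (F j) by apply: measurableI => //; exact: seqDU_measurable.
have EF : E `<=` \bigcup_j F j.
  rewrite -setI_bigcupr -seqDU_bigcup_eq => x Ex; split => //.
  have [q [k qk]] := rational_good_points (LO _ (EL _ Ex)) eps0.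
  by exists (pickle (q, k)) => //; apply: subset_closure; rewrite /c /rho pickleK.
have FE j : F j `<=` E by move=> x [].
have tF : trivIset setT F by apply: trivIset_setIl; exact: trivIset_seqDU.
have eta2 : 0 < eta / 2 by rewrite divr_gt0.
have [N [K [hK nuK]]] := finite_compact_approximation cL (nu_lty rL) mE EL mF EF FE eta2.
have cK j : compact (K j) by have [] := hK j.
have KF j : K j `<=` F j by have [] := hK j.
have KE j : K j `<=` E by move=> x /KF/FE.
have KO j : K j `<=` O by move=> x /KE/EL/LO.
have rK j : rel_compact O (K j) by exact: rel_compact_compact.
have Kdisj i j : i != j -> K i `&` K j = set0.
  move=> /eqP ij; apply/seteqP; split => // x [/KF Fix /KF Fjx].
  by apply: ij; apply: (tF i j I I); exists x.
have tK : trivIset setT K by apply/trivIsetP => i j _ _; exact: Kdisj.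
have [rU lamU] := slm_bigsetU N rK tK.
(* a is small enough for the N error terms to add up to at most eta / 2. *)
pose a := eta / 2 / N.+1%:R.
have a0 : 0 < a by rewrite divr_gt0.
have /choice[delta hdelta] : forall j, exists delta, 0 < delta /\
    forall s : seq ('rV[R]_n * R),
      (forall p, p \in s -> K j p.1 /\ 0 < p.2 < delta) -> K j `<=` balls 1 s ->
      `|lam (K j)| <= n%:R * (\sum_(p <- s)
         C / p.2 * (eps * 2 ^+ n * (n.+1%:R * p.2) ^+ n)) + a.
  move=> j.
  have [|r r0 Kr] := @closure_good_points (c j) (rho j) eps (K j) (rho0 j) (cK j) (KO j).
    by move=> x /KF[_ []].
  have := @divergence_compact_le _ _ _ _ lamP f oO mf intf divf C (K j) (c j) r
    (eps * 2 ^+ n) hC C0 (cK j) (KO j) r0 _ a a0.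
  by case=> [x t i Kx|d d0 hd]; [exact: (Kr x Kx)|exists d].
have [d1 d10 hd1] := exists_common_lower_bound N (fun j => (hdelta j).1).
have [d2 d20 hd2] := disjoint_compacts_separated N cK Kdisj.
have d0 : 0 < Num.min d1 d2 / 2 by rewrite divr_gt0// lt_min d10.
have cU : compact (\big[setU/set0]_(j < N) K j) by apply: bigsetU_compact => j _; exact: cK.
have UE : \big[setU/set0]_(j < N) K j `<=` E.
  by rewrite -bigcup_mkord => x [j _ /KE].
have [s [sd Us sB]] := sE _ cU UE _ d0.
have s0 p : p \in s -> 0 < p.2 by move=> /sd/andP[].
pose hit j (p : 'rV[R]_n * R) := `[< (K j `&` ball p.1 p.2) !=set0 >].
pose A := n%:R * C * (n.+1%:R * 2) ^+ n * 2 ^+ n.-1 * eps.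
have A0 : 0 <= A by rewrite !mulr_ge0// ?exprn_ge0// ?mulr_ge0// ltW.
have piece j : (j < N)%N ->
    `|lam (K j)| <= A * (\sum_(p <- s | hit j p) p.2 ^+ n.-1) + a.
  move=> jN; have [|s' [s'K Ks' s'E]] := @recentre R n s (K j) s0.
    by move=> x Kx; apply: Us; rewrite -bigcup_mkord; exists j.
  apply: le_trans ((hdelta j).2 s' _ Ks') _.
    move=> q /s'K[Kq [p ps ->]]; split => //.
    have /andP[p0] := sd p ps; rewrite ltr_pdivlMr// lt_min => /andP[pd _].
    rewrite mulr_gt0//= mulrC; apply: lt_le_trans pd _; exact: hd1.
  rewrite (s'E (fun t => C / t * (eps * 2 ^+ n * (n.+1%:R * t) ^+ n))).
  rewrite lerD2r mulr_sumr mulr_sumr big_seq_cond [leRHS]big_seq_cond.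
  rewrite le_eqVlt; apply/orP; left; apply/eqP.
  apply: eq_bigr => p /andP[ps _]; have p0 := s0 p ps.
  rewrite /A; move: (p.2) p0 => t t0.
  by rewrite cover_term//; ring.
have sumK : \sum_(j < N) `|lam (K j)| <= A * B + eta / 2.
  apply: (@le_trans _ _ (\sum_(j < N) (A * (\sum_(p <- s | hit j p) p.2 ^+ n.-1) + a))).
    by apply: ler_sum => j _; exact: piece.
  rewrite big_split/= -mulr_sumr; apply: lerD.
    apply: ler_wpM2l => //; apply: le_trans sB.
    rewrite (exchange_big_dep xpredT)//= big_seq [leRHS]big_seq.
    apply: ler_sum => p ps; have p0 := s0 p ps.
    apply: (@sum_at_most_one R N (fun j => hit j p)).
      by rewrite exprn_ge0// ltW.
    move=> i j iN jN /asboolP[x [Kix px]] /asboolP[y [Kjy py]].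
    apply: (hd2 i j x y iN jN Kix Kjy).
    apply: le_ball (ball_triangle (ball_sym px) py).
    have /andP[_] := sd p ps; rewrite ltr_pdivlMr// lt_min => /andP[_].
    by rewrite mulr_natr mulr2n => /ltW.
  rewrite sumr_const card_ord -[leLHS]mulr_natr /a -[leLHS]mulrA ler_piMr ?(ltW eta2)//.
  by rewrite mulrC ler_pdivrMr// mul1r ler_nat.
have rD : rel_compact O (E `\` \big[setU/set0]_(j < N) K j).
  apply: (rel_compactS rE); last exact: subDsetl.
  by apply: measurableD => //; exact: rU.1.
have lamD : `|lam (E `\` \big[setU/set0]_(j < N) K j)| <= eta / 2.
  by rewrite -lee_fin; apply: (le_trans (abs_le rD)); exact: ltW.
rewrite (slm_split lamP rE rU.1) (setIidr UE) lamU.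
apply: (le_trans (ler_normD _ _)).
apply: (le_trans (lerD (ler_norm_sum _ _ _) lamD)).
apply: (le_trans (lerD sumK (lexx _))).
have -> : n%:R * C * (n.+1%:R * 2) ^+ n * 2 ^+ n.-1 * B * eps = A * B by rewrite /A; ring.
lra.
Qed.

Lemma slm_null E B : rel_compact O E -> small_covers B E -> lam E = 0.
Proof.
move=> rE sE; have [C C0 hC] := @exists_bump_constant R n.
have B0 : 0 <= B.
  have [s [s0 _]] := sE set0 compact0 (@sub0set _ _) 1 ltr01.
  apply: le_trans; rewrite big_seq; apply: sumr_ge0 => p ps.
  by have /andP[p0 _] := s0 p ps; rewrite exprn_ge0// ltW.
pose T := n%:R * C * (n.+1%:R * 2) ^+ n * 2 ^+ n.-1 * B.
have T0 : 0 <= T by rewrite !mulr_ge0// ?exprn_ge0// mulr_ge0.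
apply/eqP; rewrite -normr_eq0 eq_le normr_ge0 andbT; apply/ler_addgt0Pr => e e0.
have e20 : 0 < e / 2 by rewrite divr_gt0.
have T1 : 0 < T + 1 by rewrite ltr_wpDl.
rewrite add0r; apply: le_trans (slm_null_eps hC C0 B0 rE sE (divr_gt0 e20 T1) e20) _.
rewrite -/T [leRHS](splitr e) lerD2r mulrCA ler_piMr ?(ltW e20)//.
by rewrite ler_pdivrMr// mul1r lerDl.
Qed.

End scalar_null.

(** * Covers from the Hausdorff measure *)

Section euclidean_balls.
Context {R : realType} {n : nat}.
Implicit Types x y : 'rV[R]_n.

Lemma coord_le_enorm x i : `|x ord0 i| <= enorm x.
Proof.
rewrite -sqrtr_sqr /enorm; apply: ler_wsqrtr; rewrite (bigD1 i)//= lerDl.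
by apply: sumr_ge0 => j _; exact: sqr_ge0.
Qed.

Lemma enorm_lt x r : 0 < r -> (forall i, `|x ord0 i| < r) -> enorm x < n.+1%:R * r.
Proof.
move=> r0 xr; have nr0 : 0 < n.+1%:R * r by rewrite mulr_gt0.
rewrite -[ltRHS]gtr0_norm// -sqrtr_sqr /enorm ltr_sqrt ?exprn_gt0//.
apply: (@le_lt_trans _ _ (\sum_(i < n) r ^+ 2)).
  apply: ler_sum => i _; rewrite -real_normK ?num_real//.
  by apply: lerXn2r; rewrite ?nnegrE ?(ltW r0)// ltW.
rewrite sumr_const card_ord exprMn -[ltLHS]mulr_natl ltr_pM2r ?exprn_gt0//.
by rewrite -natrX ltr_nat expnS expn1; exact: leq_pmulr.
Qed.

Lemma eball_sub_ball x r : 0 < r -> eball x r `<=` ball x r.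
Proof.
move=> r0 y yr; apply/ball_rVP => // i; apply: le_lt_trans yr.
by have := coord_le_enorm (y - x) i; rewrite !mxE.
Qed.

Lemma ball_sub_eball x r : 0 < r -> ball x r `<=` eball x (n.+1%:R * r).
Proof.
move=> r0 y /(ball_rVP _ _ r0) yr; apply: enorm_lt => // i.
by have := yr i; rewrite !mxE.
Qed.

Lemma measurable_eball x r : measurable (eball x r).
Proof.
pose c i : 'rV[R]_n -> R := (fun y : 'rV[R]_n => y ord0 i) + cst (- x ord0 i).
have cS i : Ck 0 setT (c i) by apply: CkD; [exact: Ck_coord|exact: Ck_cst].
have qS : Ck 0 setT (\sum_i c i * c i).
  apply: (@big_ind _ (Ck 0 setT)) => [|f g|i _]; [exact: Ck_cst|exact: CkD|exact: CkM].
have E y : enorm (y - x) = Num.sqrt ((\sum_i c i * c i) y).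
  rewrite /enorm fct_sumE; congr Num.sqrt; apply: eq_bigr => i _.
  by rewrite !mxE expr2.
apply: open_measurable_mx.
rewrite (_ : eball x r = (fun y => Num.sqrt ((\sum_i c i * c i) y)) @^-1` [set t | t < r]).
  apply: open_comp; last exact: open_lt.
  move=> y _; apply: (continuous_comp (g := Num.sqrt)); last exact: sqrt_continuous.
  exact: qS.1.
by apply/seteqP; split => y /=; rewrite /eball/= E.
Qed.

Lemma lebesgue_eball_le x r : 0 < r ->
  (lebesgue_rV n (eball x r) <= ((2 * r) ^+ n)%:E)%E.
Proof.
move=> r0; rewrite -(lebesgue_ball x r0); apply: le_measure; rewrite ?inE.
- exact: measurable_eball.
- exact: measurable_ball_rV.
- exact: eball_sub_ball.
Qed.

Lemma lebesgue_eball_gt0 x r : 0 < r -> (0 < lebesgue_rV n (eball x r))%E.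
Proof.
move=> r0; have s0 : 0 < r / n.+1%:R by rewrite divr_gt0.
apply: (@lt_le_trans _ _ (lebesgue_rV n (ball x (r / n.+1%:R)))).
  by rewrite lebesgue_ball// lte_fin exprn_gt0// mulr_gt0.
apply: le_measure; rewrite ?inE.
- exact: measurable_ball_rV.
- exact: measurable_eball.
- by have := @ball_sub_eball x _ s0; rewrite mulrCA divff ?mulr1// pnatr_eq0.
Qed.

Lemma lebesgue_eball_fin x r : 0 < r -> exists2 v, 0 < v &
  lebesgue_rV n (eball x r) = v%:E.
Proof.
move=> r0; have := lebesgue_eball_gt0 x r0; have := lebesgue_eball_le x r0.
by case: (lebesgue_rV n _) => [v| |]//=; rewrite ?lee_fin lte_fin => _; exists v.
Qed.

End euclidean_balls.

Section hausdorff_covers.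
Context {R : realType} {n : nat}.

(** Diameters may vanish while balls need positive radii: radii slightly
    larger than the diameters cost arbitrarily little. *)
Lemma exists_radius k (d e delta : R) : 0 <= d -> 0 < e -> d < delta ->
  exists r, [/\ d < r, r < delta & r ^+ k <= d ^+ k + e].
Proof.
move=> d0 e0 dd.
have := @exprn_continuous R k d => /(_ [set y | y < d ^+ k + e])[].
  by apply: open_nbhs_nbhs; split; [exact: open_lt|rewrite /= ltrDl].
move=> a /= a0 ha; pose t := Num.min (a / 2) ((delta - d) / 2).
have t0 : 0 < t by rewrite lt_min !divr_gt0// subr_gt0.
have ta : t <= a / 2 by rewrite ge_min lexx.
have td : t <= (delta - d) / 2 by rewrite ge_min lexx orbT.
exists (d + t); split; [lra|lra|apply/ltW/ha].
by rewrite /= opprD addrA subrr sub0r normrN gtr0_norm//; lra.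
Qed.

(** Replace each set of an almost optimal cover by a ball around one of its
    points, with radius slightly larger than its diameter; the excess is
    summable, and 2^k / al turns the normalised weights into powers of the
    diameters. Empty sets have weight 0 and are skipped, which matters when
    k = 0. *)
Lemma hausdorff_small_covers (U : set 'rV[R]_n) :
  (hausdorff n.-1 U < +oo)%E -> exists B, small_covers B U.
Proof.
move=> Uoo; set k := n.-1.
have [h Uh] : exists h : R, (hausdorff k U < h%:E)%E.
  move: Uoo; rewrite -/k; case: (hausdorff k U) => [v| |]// _.
    by exists (v + 1); rewrite lte_fin ltrDl.
  by exists 0; exact: ltNyr.
have [al al0 alE] := @lebesgue_eball_fin R k 0 1 ltr01.
exists (2 ^+ k / al * h + 1) => K cK KU delta delta0.
have d20 : 0 < delta / 2 by rewrite divr_gt0.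
have : (hausdorff_pre k (delta / 2) U < h%:E)%E.
  by apply: le_lt_trans Uh; apply: ereal_sup_ubound; exists (delta / 2).
move=> /ereal_inf_lt[_ [F [UF Fd] <-] Fh].
have w0 j : (0 <= hausdorff_weight k (F j))%E.
  rewrite /hausdorff_weight; case: asboolP => // /eqP/set0P[x Fx].
  rewrite alE mule_ge0 ?lee_fin ?(ltW al0)// expe_ge0// mule_ge0 ?lee_fin//.
  apply: (@le_trans _ _ (enorm (x - x))%:E).
    by rewrite lee_fin sqrtr_ge0.
  by apply: ereal_sup_ubound; exists (x, x).
pose hit j := `[< F j !=set0 >].
have /choice[q hq] : forall j, exists q : 'rV[R]_n * R, hit j ->
    [/\ F j `<=` ball q.1 q.2, 0 < q.2 < delta &
      ((q.2 ^+ k)%:E <= (2 ^+ k / al)%:E * hausdorff_weight k (F j)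
         + (1 / (2 ^ j.+1)%:R)%:E)%E].
  move=> j; have [hj|hj] := boolP (hit j); last by exists (0, 0).
  have [x Fx] := asboolP _ hj.
  have dge y z : F j y -> F j z -> ((enorm (y - z))%:E <= ediam (F j))%E.
    by move=> Fy Fz; apply: ereal_sup_ubound; exists (y, z).
  have := dge x x Fx Fx; have := Fd j.
  case E : (ediam (F j)) => [d| |]//; rewrite !lee_fin => dd2 dx.
  have d0 : 0 <= d by apply: le_trans dx; exact: sqrtr_ge0.
  have dd : d < delta by lra.
  have e0 : 0 < 1 / (2 ^ j.+1)%:R :> R by rewrite divr_gt0// ltr0n expn_gt0.
  have [r [dr rd rk]] := exists_radius k d0 e0 dd.
  have r0 : 0 < r by exact: le_lt_trans dr.
  exists (x, r) => _; split; rewrite /=.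
  - move=> y Fy; apply: eball_sub_ball => //; apply: le_lt_trans dr.
    by have := dge y x Fy Fx; rewrite E lee_fin.
  - by rewrite r0.
  - apply: (@le_trans _ _ (d ^+ k + 1 / (2 ^ j.+1)%:R)%:E); first by rewrite lee_fin.
    rewrite EFinD; apply: leeD => //; rewrite /hausdorff_weight asboolF; last first.
      by move=> F0; rewrite F0 in Fx.
    rewrite alE E -EFinM -EFin_expe -!EFinM lee_fin exprMn.
    by rewrite exprVn le_eqVlt; apply/orP; left; apply/eqP; field; rewrite expf_neq0 ?gt_eqF.
pose V N := \bigcup_(j in [set j | (j < N)%N /\ hit j]) ball (q j).1 (q j).2.
have [N KN] : exists N, K `<=` V N.
  apply: compact_increasing_cover => //.
  - by move=> N; apply: bigcup_open => j _; exact: ball_open.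
  - by move=> N M NM x [j [jN hj] xj]; exists j => //; split => //; exact: leq_trans NM.
  - move=> x /KU/UF[j _ Fjx]; exists j.+1 => //; exists j.
      by split => //; apply/asboolP; exists x.
    by have [|+ _ _] := hq j; [apply/asboolP; exists x|exact].
exists [seq q j | j <- iota 0 N & hit j]; split.
- by move=> p /mapP[j]; rewrite mem_filter => /andP[hj _] ->; have [] := hq j hj.
- move=> x /KN[j [jN hj] xj]; exists (q j); last by rewrite mul1r.
  by apply/mapP; exists j => //; rewrite mem_filter hj mem_iota.
- rewrite big_map big_filter -lee_fin -sumEFin.
  apply: (@le_trans _ _ (\sum_(j <- iota 0 N) ((2 ^+ k / al)%:E * hausdorff_weight k (F j)
         + (1 / (2 ^ j.+1)%:R)%:E))%E).
    rewrite [leRHS](bigID hit)/= -[leLHS]adde0; apply: leeD.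
      by apply: lee_sum => j hj; have [] := hq j hj.
    apply: sume_ge0 => j _; rewrite adde_ge0 ?lee_fin//.
    by rewrite mule_ge0 ?lee_fin ?divr_ge0 ?(ltW al0)// exprn_ge0.
  rewrite big_split/= EFinD; apply: leeD.
    rewrite -ge0_sume_distrr//.
    rewrite [leRHS]EFinM; apply: lee_wpmul2l.
      by rewrite lee_fin divr_ge0 ?(ltW al0)// exprn_ge0.
    apply: le_trans (ltW Fh); have := @nneseries_lim_ge R _ xpredT 0 N (fun j _ _ => w0 j).
    by rewrite /index_iota subn0.
  apply: le_trans (epsilon_trick0 xpredT ler01).
  have := @nneseries_lim_ge R (fun j => (1 / (2 ^ j.+1)%:R)%:E) xpredT 0 N.
  by rewrite /index_iota subn0; apply => j _ _; rewrite lee_fin.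
Qed.

End hausdorff_covers.

(** * Covers of hypersurfaces *)

Section graphs.
Context {R : realType} {m : nat}.

(** The coordinates other than i determine the remaining one up to a Lipschitz
    constant. Cutting the m-dimensional box of these coordinates into
    (N+1)^m cells therefore cuts A into as many pieces, each of size of order
    1/(N+1); the two powers cancel. *)
Lemma lipschitz_graph_small_covers (i : 'I_m.+1) (A : set 'rV[R]_m.+1) x rho La :
  0 < rho -> 1 <= La -> A `<=` ball x rho ->
  (forall y z t, A y -> A z -> 0 < t ->
     (forall j, j != i -> `|y ord0 j - z ord0 j| <= t) ->
     forall j, `|y ord0 j - z ord0 j| <= La * t) ->
  small_covers ((4 * La * rho) ^+ m) A.
Proof.
move=> rho0 La1 Ax lip K _ KA delta delta0.
have La0 : 0 < La by exact: lt_le_trans La1.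
pose T := 4 * La * rho.
have T0 : 0 < T by rewrite !mulr_gt0.
have dT0 : 0 < delta / T by rewrite divr_gt0.
have [N _ /(_ N (leqnn _)) /= hN] := near_infty_natSinv_lt (PosNum dT0).
pose a : R := N.+1%:R.
have a0 : 0 < a by rewrite ltr0n.
pose r := T / a; pose t := 2 * rho / a.
have t0 : 0 < t by rewrite !mulr_gt0// invr_gt0.
have r0 : 0 < r by rewrite mulr_gt0// invr_gt0.
(* The coordinate in units of the side t of a cell; its integer part is the
   index of the cell. *)
pose v (y : 'rV[R]_m.+1) j := (y ord0 (lift i j) - x ord0 (lift i j) + rho) / t.
pose idx y : {ffun 'I_m -> 'I_N.+1} := [ffun j => inord (Num.truncn (v y j))].
have v_itv y j : A y -> 0 <= v y j < a.
  move=> /Ax /(ball_rVP _ _ rho0) /(_ (lift i j)); rewrite ltr_norml => /andP[y1 y2].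
  rewrite divr_ge0 ?(ltW t0)//=; last by lra.
  by rewrite ltr_pdivrMr// /t mulrC divfK ?gt_eqF//; lra.
have idxP y z j : A y -> A z -> idx y = idx z ->
    `|y ord0 (lift i j) - z ord0 (lift i j)| <= t.
  move=> Ay Az /ffunP /(_ j); rewrite !ffunE => /(congr1 (@nat_of_ord _)).
  have /andP[y0 ya] := v_itv y j Ay; have /andP[z0 za] := v_itv z j Az.
  rewrite !inordK ?truncn_lt_nat// => e.
  have := truncn_itv y0; have := truncn_itv z0; rewrite e -natr1.
  move: (_%:R) => k /andP[k1 k2] /andP[k3 k4].
  have -> : y ord0 (lift i j) - z ord0 (lift i j) = (v y j - v z j) * t.
    by rewrite -mulrBl mulfVK ?gt_eqF//; ring.
  rewrite normrM (gtr0_norm t0) ler_piMl ?(ltW t0)// ler_norml; lra.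
pose P c : set 'rV[R]_m.+1 := A `&` [set y | idx y = c].
exists [seq (get (P c), r) | c <- enum {: {ffun 'I_m -> 'I_N.+1}} & `[< P c !=set0 >]].
split.
- move=> p /mapP[c _ ->] /=; rewrite r0/= /r mulrC.
  by rewrite -ltr_pdivlMr// ; rewrite /a.
- move=> y /KA Ay; have Py : P (idx y) y by [].
  exists (get (P (idx y)), r).
    apply/mapP; exists (idx y) => //; rewrite mem_filter mem_enum andbT.
    by apply/asboolP; exists y.
  have [Aq iq] := getI Py; rewrite /= mul1r.
  move: (get _) Aq iq => q Aq iq; apply/ball_rVP => // j.
  apply: (@le_lt_trans _ _ (La * t)).
    apply: lip => // k ki; case: (unliftP i k) => [l ->|ke]; first exact: idxP.
    by rewrite ke eqxx in ki.
  have -> : r = 2 * (La * t) by rewrite /r /t /T; ring.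
  by rewrite mulr_natl mulr2n ltrDl mulr_gt0.
- rewrite big_map /= big_const_seq iter_addr_0.
  apply: (@le_trans _ _ (r ^+ m *+ (N.+1 ^ m))).
    rewrite -[leLHS]mulr_natl -[leRHS]mulr_natl; apply: ler_wpM2r.
      by rewrite exprn_ge0// ltW.
    rewrite ler_nat; apply: leq_trans (count_size _ _) _; rewrite size_filter.
    apply: leq_trans (count_size _ _) _.
    by rewrite -cardE card_ffun !card_ord.
  rewrite -mulr_natr natrX -exprMn /r -/T.
  by rewrite -/a divfK ?gt_eqF.
Qed.

End graphs.

Section mean_value.
Context {R : realType}.

Lemma MVT_between (f df : R -> R) (a b : R) :
  (forall x, Num.min a b <= x <= Num.max a b -> is_derive x 1 f (df x)) ->
  exists c, Num.min a b <= c <= Num.max a b /\ f b - f a = df c * (b - a).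
Proof.
wlog ab : a b / a <= b => [hw dfx|].
  have /orP[ab|ba] := le_total a b; first by apply: hw.
  have [|c [cab e]] := hw b a ba.
    by move=> x; rewrite minC maxC; exact: dfx.
  exists c; split; first by rewrite minC maxC.
  by rewrite -[LHS]opprB e; ring.
rewrite min_l// max_r// => dfx.
have [x xab||c cab e] := @MVT_segment R f df a b ab.
- by apply: dfx; move: xab; rewrite in_itv/= => /andP[/ltW-> /ltW].
- apply: derivable_within_continuous => x xab.
  have xab' : a <= x <= b by move: xab; rewrite in_itv.
  by case: (dfx x xab').
- by exists c; split => //; move: cab; rewrite in_itv.
Qed.

Lemma is_derive_line n (g : 'rV[R]_n -> R) (p v : 'rV[R]_n) (t : R) :
  derivable g (t *: v + p) v ->
  is_derive t 1 (fun s : R => g (s *: v + p)) ('D_v g (t *: v + p)).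
Proof.
move=> dg.
have E : (fun h : R => h^-1 *: (((fun s : R => g (s *: v + p)) \o shift t) (h *: 1)
      - g (t *: v + p))) =
    (fun h : R => h^-1 *: ((g \o shift (t *: v + p)) (h *: v) - g (t *: v + p))).
  apply/funext => h; rewrite /= [h *: 1](_ : _ = h); last exact: mulr1.
  by rewrite scalerDl addrA.
by apply: DeriveDef; rewrite /derivable /derive E.
Qed.

(** Move from z to y one coordinate at a time; the intermediate points stay in
    the ball because it is a cube. *)
Lemma mean_value_coordinates n (g : 'rV[R]_n -> R) (x y z : 'rV[R]_n) rho :
  0 < rho -> ball x rho y -> ball x rho z ->
  (forall p i, ball x rho p -> derivable g p 'e_i) ->
  exists xi : 'I_n -> 'rV[R]_n, (forall i, ball x rho (xi i)) /\
    g y - g z = \sum_i 'D_'e_i g (xi i) * (y ord0 i - z ord0 i).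
Proof.
move=> rho0 /(ball_rVP _ _ rho0) xy /(ball_rVP _ _ rho0) xz dg.
(* H interpolates between z = H 0 and y = H n. *)
pose H (k : nat) : 'rV[R]_n := \row_j (if (j < k)%N then y ord0 j else z ord0 j).
have step (k : 'I_n) : exists xi, ball x rho xi /\
    g (H k.+1) - g (H k) = 'D_'e_k g xi * (y ord0 k - z ord0 k).
  pose d := y ord0 k - z ord0 k.
  have Hk : H k.+1 = d *: 'e_k + H k.
    apply/rowP => j; rewrite !mxE eqxx/= ltnS.
    case: (ltngtP j k) => [jk|jk|/val_inj ->].
    - by rewrite -val_eqE/= (ltn_eqF jk) mulr0 add0r.
    - by rewrite -val_eqE/= (gtn_eqF jk) mulr0 add0r.
    - by rewrite eqxx mulr1 /d subrK.
  have inball t : Num.min 0 d <= t <= Num.max 0 d -> ball x rho (t *: 'e_k + H k).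
    move=> tin; apply/ball_rVP => // j; rewrite !mxE eqxx/=.
    have [->|jk] := eqVneq j k; last by rewrite mulr0 add0r; case: ifP.
    rewrite ltnn mulr1; have := xy k; have := xz k; rewrite !ltr_norml.
    move: tin; rewrite /d; move: (y ord0 k) (z ord0 k) (x ord0 k) => yk zk xk.
    by rewrite minEle maxEle; case: ifP => _ /andP[? ?] /andP[? ?] /andP[? ?]; lra.
  have [t|c [cin e]] := @MVT_between (fun t => g (t *: 'e_k + H k))
      (fun t => 'D_'e_k g (t *: 'e_k + H k)) 0 d.
    by move=> tin; apply: is_derive_line; apply: dg; exact: inball.
  exists (c *: 'e_k + H k); split; first exact: inball.
  by rewrite Hk; move: e; rewrite scale0r add0r subr0.
have [xi hxi] := fin_all_exists step.
exists xi; split; first by move=> i; have [] := hxi i.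
have -> : g y - g z = g (H n) - g (H 0%N).
  congr (g _ - g _); apply/rowP => j; rewrite mxE ?ltn_ord//.
rewrite -(telescope_sumr (fun k => g (H k)) (leq0n n)) big_mkord.
by apply: eq_bigr => i _; have [] := hxi i.
Qed.

End mean_value.

Section hypersurfaces.
Context {R : realType} {m : nat}.

(** Near a point where D_i g does not vanish, the mean value theorem for
    g y = g z = 0 bounds |y_i - z_i| by the other coordinates: the part of M
    near x is a Lipschitz graph over the hyperplane of these. *)
Lemma C1_hypersurface_local_covers (M : set 'rV[R]_m.+1) x :
  C1_hypersurface M -> M x ->
  exists rho B, 0 < rho /\ small_covers B (M `&` ball x rho).
Proof.
move=> hM Mx; have [Q [g [oQ Qx [_ Cg] gi MQ]]] := hM x Mx.
have [i gi0] := gi x Qx.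
have cD j : {for x, continuous ('D_'e_j g)} by have [_ [h _]] := Cg j; exact: h.
(* On a small ball, D_i g stays above a and all partial derivatives below b. *)
pose a := `|'D_'e_i g x| / 2.
have a0 : 0 < a by rewrite divr_gt0// normr_gt0.
pose b := \sum_j (`|'D_'e_j g x| + a).
have b0 : 0 <= b by apply: sumr_ge0 => j _; rewrite addr_ge0// ltW.
have near_x : nbhs x [set y | Q y /\ forall j, `|'D_'e_j g x - 'D_'e_j g y| < a].
  near=> y; split; first by near: y; exact: open_nbhs_nbhs.
  near: y; apply: filter_forall => j.
  by have /cvgrPdist_lt := cD j; apply.
have /nbhs_ballP[rho /= rho0 hrho] := near_x.
have La1 : 1 <= m.+1%:R * b / a + 1 by rewrite lerDr divr_ge0 ?(ltW a0)// mulr_ge0.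
exists rho, ((4 * (m.+1%:R * b / a + 1) * rho) ^+ m); split => //.
apply: (@lipschitz_graph_small_covers R m i _ x) => //.
move=> y z t [My xy] [Mz xz] t0 yz j.
have [Qy _] := hrho y xy; have [Qz _] := hrho z xz.
have gy : g y = 0 by have : (M `&` Q) y by []; rewrite MQ => -[].
have gz : g z = 0 by have : (M `&` Q) z by []; rewrite MQ => -[].
have [|xi [xiB]] := @mean_value_coordinates R m.+1 g x y z rho rho0 xy xz.
  by move=> p k /hrho[Qp _]; have [h _] := Cg k; exact: h.
rewrite gy gz subrr (bigD1 i)//= => e.
have [->|ji] := eqVneq j i.
  have ai : a <= `|'D_'e_i g (xi i)|.
    have [_ /(_ i)] := hrho _ (xiB i); rewrite /a => h.
    have := ler_normD ('D_'e_i g x - 'D_'e_i g (xi i)) ('D_'e_i g (xi i)).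
    by rewrite subrK; lra.
  have bk k : `|'D_'e_k g (xi k)| <= b.
    have [_ /(_ k) h] := hrho _ (xiB k).
    apply: (@le_trans _ _ (`|'D_'e_k g x| + a)).
      have := ler_normB ('D_'e_k g x) ('D_'e_k g x - 'D_'e_k g (xi k)).
      by rewrite opprB addrC subrK; lra.
    rewrite /b (bigD1 k)//= lerDl; apply: sumr_ge0 => l _.
    by rewrite addr_ge0// ltW.
  have : a * `|y ord0 i - z ord0 i| <= m.+1%:R * b * t.
    apply: (@le_trans _ _ `|'D_'e_i g (xi i) * (y ord0 i - z ord0 i)|).
      by rewrite normrM; apply: ler_wpM2r.
    have -> : 'D_'e_i g (xi i) * (y ord0 i - z ord0 i) =
        - (\sum_(k < m.+1 | k != i) 'D_'e_k g (xi k) * (y ord0 k - z ord0 k)).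
      by apply/eqP; rewrite -addr_eq0 -e.
    rewrite normrN; apply: (le_trans (ler_norm_sum _ _ _)).
    apply: (@le_trans _ _ (\sum_(k < m.+1 | k != i) b * t)).
      apply: ler_sum => k ki; rewrite normrM; apply: ler_pM => //; exact: yz.
    apply: (@le_trans _ _ (\sum_(k < m.+1) b * t)).
      rewrite [leRHS](bigID (fun k => k != i))/= lerDl; apply: sumr_ge0 => k _.
      by rewrite mulr_ge0// ltW.
    by rewrite sumr_const card_ord -[leLHS]mulr_natl mulrA.
  rewrite -ler_pdivlMl// => h; apply: (le_trans h).
  have -> : a^-1 * (m.+1%:R * b * t) = m.+1%:R * b / a * t by ring.
  by apply: ler_wpM2r; [exact: ltW|rewrite lerDl].
apply: (le_trans (yz j ji)).
by rewrite ler_peMl// ltW.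
Unshelve. all: by end_near. Qed.

(** M is locally closed, hence the intersection of its closure with an open
    set. *)
Lemma C1_hypersurface_measurable (M : set 'rV[R]_m.+1) :
  C1_hypersurface M -> measurable M.
Proof.
move=> hM.
(* W collects the open sets in which M is relatively closed. *)
pose W := \bigcup_(Q in [set Q | open Q /\ closure M `&` Q `<=` M]) Q.
have oW : open W by apply: bigcup_open => Q [].
suff -> : M = closure M `&` W.
  apply: measurableI; last exact: open_measurable_mx.
  by apply: closed_measurable_rV; exact: closed_closure.
apply/seteqP; split => [x Mx|x [clx [Q [oQ QM] Qx]]]; last exact: QM.
split; first exact: subset_closure.
have [Q [g [oQ Qx [cg _] _ MQ]]] := hM x Mx.
exists Q => //; split => // y [cly Qy].
suff : (M `&` Q) y by case.
rewrite MQ; split => //; apply/eqP/negPn/negP => gy0.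
have : nbhs y (Q `&` g @^-1` [set t | t != 0]).
  apply: filterI; first exact: open_nbhs_nbhs.
  apply: (cg y Qy); apply: open_nbhs_nbhs; split; [exact: open_neq|exact: gy0].
move=> /cly[z [Mz [Qz gz0]]].
have : (M `&` Q) z by []; rewrite MQ => -[_ gz].
by rewrite /= gz eqxx in gz0.
Qed.

End hypersurfaces.

(** * Inner products on finite-dimensional spaces *)

Section inner_product.
Context {R : realType} {V : vectType R} (dot : {dot V for idfun}).
Implicit Types u v w : V.

Lemma dotC u v : dot u v = dot v u.
Proof. by rewrite hermC expr0 mul1r. Qed.

Lemma dotDl u v w : dot (u + v) w = dot u w + dot v w.
Proof. exact: linearDl. Qed.

Lemma dotNl u w : dot (- u) w = - dot u w.
Proof. exact: linearNl. Qed.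

Lemma dotZl a u w : dot (a *: u) w = a * dot u w.
Proof. exact: linearZl_LR. Qed.

Lemma dot0l w : dot 0 w = 0.
Proof. exact: linear0l. Qed.

Lemma dotBl u v w : dot (u - v) w = dot u w - dot v w.
Proof. by rewrite dotDl dotNl. Qed.

Lemma dot_suml I (r : seq I) P (F : I -> V) w :
  dot (\sum_(i <- r | P i) F i) w = \sum_(i <- r | P i) dot (F i) w.
Proof. exact: linear_sumlz. Qed.

Lemma dot_gt0 u : u != 0 -> 0 < dot u u.
Proof. exact: neq0_dnorm_gt0. Qed.

Lemma dot_ge0 u : 0 <= dot u u.
Proof. by have [->|/dot_gt0/ltW//] := eqVneq u 0; rewrite dot0l. Qed.

Lemma dot_eq0 u : dot u u = 0 -> u = 0.
Proof. by move=> h; apply/eqP/negPn/negP => /dot_gt0; rewrite h ltxx. Qed.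

Lemma dnorm_nneg u : 0 <= dnorm dot u. Proof. exact: sqrtr_ge0. Qed.

Lemma cauchy_schwarz u v : `|dot u v| <= dnorm dot u * dnorm dot v.
Proof.
have [->|v0] := eqVneq v 0.
  by rewrite dotC dot0l normr0 mulr_ge0// dnorm_nneg.
have vv := dot_gt0 v0.
rewrite /dnorm -sqrtrM ?dot_ge0// -sqrtr_sqr; apply: ler_wsqrtr.
have := dot_ge0 (u - (dot u v / dot v v) *: v).
set t := dot u v / dot v v.
rewrite dotBl dotZl (dotC u (_ - _)) (dotC v (_ - _)) !dotBl !dotZl (dotC v u).
have -> : dot u u - t * dot u v - t * (dot u v - t * dot v v) =
    (dot u u * dot v v - dot u v ^+ 2) / dot v v.
  by rewrite /t; field; rewrite gt_eqF.
by rewrite pmulr_lge0 ?invr_gt0// subr_ge0.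
Qed.

(** The Gram matrix of a basis is invertible because the form is definite, so
    the linear system for the coordinates of r can be solved. *)
Lemma riesz (l : {linear V -> R^o}) : exists r, forall v, l v = dot v r.
Proof.
pose m := \dim {:V}; pose e : m.-tuple V := vbasis {:V}.
pose M : 'M[R]_m := \matrix_(i, j) dot (e`_i) (e`_j).
have coordE v : v = \sum_i coord e i v *: e`_i.
  by rewrite -coord_vbasis// memvf.
have Mu : M \in unitmx.
  rewrite -row_free_unit; apply: inj_row_free => x xM.
  pose v := \sum_i x ord0 i *: e`_i.
  have ve (j : 'I_m) : dot v (e`_j) = 0.
    have := congr1 (fun A : 'rV[R]_m => A ord0 j) xM; rewrite !mxE => <-.
    by rewrite dot_suml; apply: eq_bigr => i _; rewrite dotZl !mxE.
  have v0 : v = 0.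
    apply: dot_eq0; rewrite {1}/v dot_suml big1// => i _.
    by rewrite dotZl dotC ve mulr0.
  have /freeP fe : free e by apply: basis_free; exact: vbasisP.
  by apply/rowP => i; rewrite mxE; apply: (fe (fun i => x ord0 i)).
pose y : 'cV[R]_m := invmx M *m (\col_i l (e`_i)).
exists (\sum_j y j ord0 *: e`_j) => v.
rewrite (coordE v) dot_suml linear_sum; apply: eq_bigr => i _.
rewrite dotZl linearZ /=; congr (_ * _).
have : M *m y = \col_i l (e`_i) by rewrite /y mulKVmx.
move=> /(congr1 (fun A : 'cV[R]_m => A i ord0)); rewrite !mxE => <-.
rewrite dotC dot_suml; apply: eq_bigr => j _.
by rewrite dotZl !mxE mulrC dotC.
Qed.

(** Expresses the square of the norm by finitely many linear functionals, each
    of which is represented by a vector: this reduces measurability of the norm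
    of u to that of the components of u. *)
Lemma dot_self_expansion : exists (m : nat) (r e : 'I_m -> V),
  forall u, dot u u = \sum_i dot u (r i) * dot u (e i).
Proof.
pose m := \dim {:V}; pose e : m.-tuple V := vbasis {:V}.
have /fin_all_exists[r hr] : forall i : 'I_m, exists r, forall v, coord e i v = dot v r.
  by move=> i; exact: (riesz (coord e i)).
exists m, r, (fun i => e`_i) => u.
have uE : u = \sum_i coord e i u *: e`_i by rewrite -coord_vbasis// memvf.
rewrite {1}uE dot_suml.
by apply: eq_bigr => i _; rewrite dotZl hr (dotC _ u).
Qed.

Lemma measurable_dnorm_sub d (T : measurableType d) (D : set T) (u : T -> V) z :
  measurable D -> (forall v, measurable_fun D (fun x => dot (u x) v)) ->
  measurable_fun D (fun x => dnorm dot (u x - z)).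
Proof.
move=> mD mu; have [m [r [e E]]] := dot_self_expansion.
rewrite /dnorm; apply: (@measurableT_comp _ _ _ _ _ _ (@Num.sqrt R)).
  exact: continuous_measurable_fun (@sqrt_continuous R).
under eq_fun do rewrite E.
apply: measurable_sum => i; apply: measurable_funM.
  under eq_fun do rewrite dotBl.
  by apply: measurable_funB; [exact: mu|exact: measurable_cst].
under eq_fun do rewrite dotBl.
by apply: measurable_funB; [exact: mu|exact: measurable_cst].
Qed.

End inner_product.

(** * From the scalar to the vector-valued measure *)

Section exhaustion.
Context {R : realType} {n : nat}.

(** The variation is a supremum over partitions into relatively compact pieces,
    which has to be nonempty to be 0. *)
Lemma rel_compact_partition (O U : set 'rV[R]_n) : open O -> U `<=` O ->
  measurable U -> exists F : (set 'rV[R]_n)^nat,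
    [/\ forall j, rel_compact O (F j), trivIset setT F & \bigcup_j F j = U].
Proof.
move=> oO UO mU.
pose K j := erosion O j.+1%:R^-1 `&` [set v | forall i, `[- j%:R, j%:R]%classic (v ord0 i)].
have cK j : compact (K j).
  rewrite /K setIC; apply: compact_closedI; last exact: closed_erosion.
  by apply: (@rV_compact R n (fun=> `[- j%:R, j%:R]%classic)) => i; exact: segment_compact.
have KO j : K j `<=` O by move=> x [/erosion_sub + _]; apply; rewrite invr_gt0.
have mK j := compact_measurable_rV (cK j).
exists (fun j => U `&` seqDU K j); split.
- move=> j; apply: (rel_compactS (rel_compact_compact (cK j) (KO j))).
    by apply: measurableI => //; exact: seqDU_measurable.
  by move=> x [_ []].
- by apply: trivIset_setIl; exact: trivIset_seqDU.
- rewrite -setI_bigcupr -seqDU_bigcup_eq; apply: setIidl => x /UO Ox.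
  have [k hk] := open_erosion oO Ox.
  have [M M0 xM] : exists2 M, 0 < M & forall i, `|x ord0 i| < M.
    have [M M0 /(_ x erefl)] := compact_sub_ball (@compact_set1 _ x).
    by move=> /(ball_rVP _ _ M0) h; exists M => // i; have := h i; rewrite mxE subr0.
  exists (maxn k (Num.truncn M).+1) => //; split.
    by apply: hk; exact: leq_maxl.
  move=> i /=; rewrite in_itv/= -ler_norml; apply: le_trans (ltW (xM i)) _.
  apply: (@le_trans _ _ (Num.truncn M).+1%:R); first exact/ltW/truncnS_gt.
  by rewrite ler_nat leq_maxr.
Qed.

End exhaustion.

Section reduction.
Context {R : realType} {n : nat} {V W : vectType R}.
Variables (dotV : {dot V for idfun}) (dotW : {dot W for idfun}).
Variables (A : 'I_n -> 'Hom(V, W)) (O : set 'rV[R]_n).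
Variables (u : 'rV[R]_n -> V) (Au : set 'rV[R]_n -> W).
Hypothesis oO : open O.
Hypothesis uL : L1loc dotV O u.
Hypothesis ucont : forall x, O x -> approx_Lebesgue_continuous dotV u x.
Hypothesis Aum : local_measure dotW O Au.
Hypothesis dist : distribution_is_measure dotW A O u Au.
Local Notation mu := (lebesgue_rV n).

Let mO : measurable O. Proof. exact: open_measurable_mx. Qed.

Let mdnorm z (D : set 'rV[R]_n) : D `<=` O ->
  measurable_fun D (fun x => (dnorm dotV (u x - z))%:E).
Proof.
move=> DO; apply/measurable_EFinP; apply: (measurable_funS mO DO).
by apply: measurable_dnorm_sub => //; exact: uL.1.
Qed.

Lemma component_scalar_local_measure w :
  scalar_local_measure O (fun E => dotW (Au E) w).
Proof.
move=> F rF tF rU; have h := Aum rF tF rU.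
apply/cvgrPdist_lt => e e0.
have w0 : 0 < dnorm dotW w + 1 by rewrite ltr_wpDl// dnorm_nneg.
have ew0 : 0 < e / (dnorm dotW w + 1) by rewrite divr_gt0.
move/cvgrPdist_lt : h => /(_ _ ew0); apply: filterS => N.
rewrite sub0r normrN ger0_norm ?dnorm_nneg// ltr_pdivlMr// => hN.
rewrite -dot_suml distrC -dotBl; apply: (le_lt_trans (cauchy_schwarz _ _ _)).
by apply: le_lt_trans hN; rewrite ler_wpM2l ?dnorm_nneg// lerDl.
Qed.

Lemma component_functional w i : exists v, forall z, dotW (A i z) w = dotV z v.
Proof.
pose l (z : V) : R^o := dotW (A i z) w.
have ll : linear l.
  by move=> a x y; rewrite /l linearP dotDl dotZl.
pose lM := GRing.isLinear.Build _ _ _ _ l ll.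
pose L : {linear V -> R^o} := HB.pack l lM.
by have [v hv] := riesz dotV L; exists v => z; rewrite -hv.
Qed.

(** Cubes and Euclidean balls of comparable radii contain each other, so
    the averages over either kind tend to 0 together; the volume of Euclidean
    balls is only needed up to a constant. *)
Lemma approx_Lebesgue_ball x : O x -> exists z, forall eps, 0 < eps ->
  exists2 rho, 0 < rho & forall r, 0 < r < rho ->
    (\int[mu]_(y in ball x r) (dnorm dotV (u y - z))%:E <= (eps * r ^+ n)%:E)%E.
Proof.
move=> Ox; have [z hz] := ucont Ox; exists z => eps eps0.
pose b : R := n.+1%:R.
have b0 : 0 < b by rewrite ltr0n.
pose e := eps / (2 * b) ^+ n.
have e0 : 0 < e by rewrite divr_gt0// exprn_gt0// mulr_gt0.
have : (limf_esup (fun r : R => (mu (eball x r))^-1 *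
    \int[mu]_(y in eball x r) (dnorm dotV (u y - z))%:E) 0%R^'+ < e%:E)%E.
  by rewrite hz lte_fin.
rewrite /limf_esup => /ereal_inf_lt[_ [P P0 <-] hP].
have [rho1 /= rho10 hrho1] := P0.
have /nbhs_ballP[d /= d0 dO] : nbhs x O by exact: open_nbhs_nbhs.
exists (Num.min rho1 d / b); first by rewrite divr_gt0// lt_min rho10.
move=> r /andP[r0]; rewrite ltr_pdivlMr// lt_min mulrC => /andP[rr rd].
have br0 : 0 < b * r by rewrite mulr_gt0.
have EO : eball x (b * r) `<=` O.
  move=> y /(eball_sub_ball br0) xy; apply: dO; apply: le_ball xy; exact: ltW.
apply: (@le_trans _ _ (\int[mu]_(y in eball x (b * r)) (dnorm dotV (u y - z))%:E)%E).
  apply: ge0_subset_integral => //.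
  - exact: measurable_ball_rV.
  - exact: measurable_eball.
  - exact: mdnorm.
  - by move=> y _; rewrite lee_fin dnorm_nneg.
  - exact: ball_sub_eball.
have [v v0 vE] := lebesgue_eball_fin x br0.
have Pr : P (b * r).
  apply: hrho1 => //=; rewrite sub0r normrN gtr0_norm//.
have := le_lt_trans (ereal_sup_ubound (ex_intro2 _ _ _ Pr erefl)) hP.
rewrite vE inver (gt_eqF v0) => h.
set I := (\int[mu]_(y in _) _)%E in h *.
have {}h : (I <= (e * v)%:E)%E.
  rewrite mulrC EFinM -lee_pdivrMl//; exact: ltW.
apply: (le_trans h); rewrite lee_fin.
have vle : v <= (2 * (b * r)) ^+ n by rewrite -lee_fin -vE; exact: lebesgue_eball_le.
apply: (@le_trans _ _ (e * (2 * (b * r)) ^+ n)); first by rewrite ler_wpM2l// ltW.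
by rewrite mulrA exprMn mulrA /e divfK// expf_neq0// mulf_neq0// gt_eqF.
Qed.

(** Apply the scalar result to the component of Au along w = Au E. *)
Lemma local_measure_null E B : (0 < n)%N -> rel_compact O E -> small_covers B E ->
  Au E = 0.
Proof.
move=> n0 rE sE; apply: (@dot_eq0 _ _ dotW).
pose w := Au E.
have /fin_all_exists[v hv] := component_functional w.
pose f i x := dotW (A i (u x)) w.
have fE i x : f i x = dotV (u x) (v i) by exact: hv.
have mf i : measurable_fun O (f i).
  by rewrite (_ : f i = fun x => dotV (u x) (v i)); [exact: uL.1|apply/funext => x].
have key := @slm_null R n O _ (@component_scalar_local_measure w) f n0 oO mf.
apply: (key _ _ _ E B rE sE).
- move=> i K cK KO; have mK := compact_measurable_rV cK.
  apply: (@le_lt_trans _ _ (\int[mu]_(x in K)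
      ((dnorm dotV (v i))%:E * (dnorm dotV (u x - 0))%:E))%E).
    apply: ge0_le_integral => //.
    + by apply/measurable_EFinP; apply: measurableT_comp => //; exact: measurable_funS (mf i).
    + by apply: measurable_funeM; exact: mdnorm.
    + by move=> x _; rewrite -EFinM lee_fin fE subr0 mulrC; exact: cauchy_schwarz.
  rewrite ge0_integralZl//; last 3 first.
  + exact: mdnorm.
  + by move=> x _; rewrite lee_fin dnorm_nneg.
  + by rewrite lee_fin dnorm_nneg.
  under eq_integral do rewrite subr0.
  by apply: lte_mul_pinfty => //; [rewrite lee_fin dnorm_nneg|exact: uL.2].
- by move=> phi tphi; exact: (dist tphi w).
- move=> x Ox; have [z hz] := approx_Lebesgue_ball Ox.
  exists (\row_i dotV z (v i)) => eps eps0.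
  pose Nv := \sum_i dnorm dotV (v i) + 1.
  have Nv0 : 0 < Nv by rewrite ltr_wpDl// sumr_ge0// => i _; exact: dnorm_nneg.
  have vN i : dnorm dotV (v i) <= Nv.
    rewrite /Nv (bigD1 i)//= -addrA lerDl addr_ge0// sumr_ge0// => j _.
    exact: dnorm_nneg.
  have [rho1 rho10 hrho1] := hz _ (divr_gt0 eps0 Nv0).
  have /nbhs_ballP[d /= d0 dO] : nbhs x O by exact: open_nbhs_nbhs.
  exists (Num.min rho1 d); first by rewrite lt_min rho10.
  move=> r i /andP[r0]; rewrite lt_min => /andP[rr rd].
  have BO : ball x r `<=` O.
    by move=> y xy; apply: dO; apply: le_ball xy; exact: ltW.
  apply: (@le_trans _ _ (\int[mu]_(y in ball x r) (Nv%:E * (dnorm dotV (u y - z))%:E))%E).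
    apply: ge0_le_integral => //.
    + exact: measurable_ball_rV.
    + apply/measurable_EFinP; apply: measurableT_comp => //.
      apply: measurable_funB; last exact: measurable_cst.
      exact: measurable_funS (mf i).
    + by apply: measurable_funeM; exact: mdnorm.
    + move=> y _; rewrite -EFinM lee_fin fE mxE -dotBl.
      apply: (le_trans (cauchy_schwarz _ _ _)); rewrite mulrC.
      by apply: ler_wpM2r; [exact: dnorm_nneg|exact: vN].
  rewrite ge0_integralZl//; last 4 first.
  + exact: measurable_ball_rV.
  + exact: mdnorm.
  + by move=> y _; rewrite lee_fin dnorm_nneg.
  + by rewrite lee_fin ltW.
  rewrite muleC -lee_pdivlMr// -EFinM.
  rewrite [X in X%:E](_ : _ = eps / Nv * r ^+ n); last by ring.
  by apply: hrho1; rewrite r0.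
Qed.

Lemma local_measure_null_bigcup (U : (set 'rV[R]_n)^nat) E : (0 < n)%N ->
  (forall k, measurable (U k)) -> (forall k, exists B, small_covers B (U k)) ->
  rel_compact O E -> E `<=` \bigcup_k U k -> Au E = 0.
Proof.
move=> n0 mU sU rE EU.
have EE : E = \bigcup_k (E `&` seqDU U k).
  by rewrite -setI_bigcupr -seqDU_bigcup_eq; apply/esym/setIidl.
have rk k : rel_compact O (E `&` seqDU U k).
  apply: (rel_compactS rE); last by move=> x [].
  by apply: measurableI; [exact: rE.1|exact: seqDU_measurable].
have null k : Au (E `&` seqDU U k) = 0.
  have [B sB] := sU k; apply: (local_measure_null n0 (rk k)).
  by apply: small_coversS sB => x [_ []].
have tE : trivIset setT (fun k => E `&` seqDU U k).
  by apply: trivIset_setIl; exact: trivIset_seqDU.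
apply: (@dot_eq0 _ _ dotW).
have := @component_scalar_local_measure (Au E) _ rk.
rewrite -EE => /(_ tE rE) h.
rewrite -(cvg_lim (@Rhausdorff R) h); apply: lim_near_cst => //.
by near=> N; rewrite big1// => k _; rewrite null dot0l.
Unshelve. all: by end_near. Qed.

Lemma variation_measure_null_bigcup (F : (set 'rV[R]_n)^nat) U : (0 < n)%N ->
  (forall k, measurable (F k)) -> (forall k, exists B, small_covers B (F k)) ->
  U `<=` O -> measurable U -> U `<=` \bigcup_k F k ->
  variation_measure dotW O Au U = 0%E.
Proof.
move=> n0 mF sF UO mU UF.
have zero (G : (set 'rV[R]_n)^nat) : (forall j, rel_compact O (G j)) ->
    \bigcup_j G j = U -> (\sum_(j <oo) (dnorm dotW (Au (G j)))%:E = 0)%E.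
  move=> rG GU; apply: eseries0 => j _ _.
  rewrite (local_measure_null_bigcup n0 mF sF (rG j)).
    by rewrite /dnorm dot0l sqrtr0.
  by apply: subset_trans UF; rewrite -GU; exact: bigcup_sup.
apply/eqP; rewrite eq_le; apply/andP; split.
  by apply: ge_ereal_sup => _ [G [rG _ GU] <-]; rewrite zero.
have [G [rG tG GU]] := rel_compact_partition oO UO mU.
by apply: ereal_sup_ubound; exists G => //; exact: zero.
Qed.

End reduction.

Theorem corollary5p3 (R : realType) (n : nat) (V W : vectType R)
    (dotV : {dot V for idfun}) (dotW : {dot W for idfun})
    (A : 'I_n -> 'Hom(V, W)) (Omega : set 'rV[R]_n)
    (u : 'rV[R]_n -> V) (Au : set 'rV[R]_n -> W) :
  (0 < n)%N -> open Omega ->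
  L1loc dotV Omega u ->
  (forall x, Omega x -> approx_Lebesgue_continuous dotV u x) ->
  local_measure dotW Omega Au ->
  distribution_is_measure dotW A Omega u Au ->
  [/\ forall U : set 'rV[R]_n, U `<=` Omega -> measurable U ->
        sigma_finite U (hausdorff n.-1) ->
        variation_measure dotW Omega Au U = 0%E,
      forall U : set 'rV[R]_n, U `<=` Omega -> measurable U ->
        (hausdorff n.-1 U < +oo)%E ->
        variation_measure dotW Omega Au U = 0%E
    & forall M : set 'rV[R]_n, M `<=` Omega -> C1_hypersurface M ->
        variation_measure dotW Omega Au M = 0%E].
Proof.
move=> n0 oO uL ucont Aum dist.
have null := variation_measure_null_bigcup oO uL ucont Aum dist n0.
split.
- move=> U UO mU [F UF hF]; apply: (null F) => //; last by rewrite UF.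
  + by move=> k; have [] := hF k.
  + by move=> k; apply: hausdorff_small_covers; have [] := hF k.
- move=> U UO mU hU; apply: (null (fun=> U)) => //.
  + by move=> _; exact: hausdorff_small_covers.
  + by move=> x Ux; exists 0%N.
- case: n n0 A Omega u Au oO uL ucont Aum dist null => // m n0 A O u Au _ _ _ _ _ null M MO hM.
  have mM := C1_hypersurface_measurable hM.
  pose cell (p : 'rV[rat]_m.+1 * nat) : set 'rV[R]_m.+1 :=
    M `&` ball (map_mx ratr p.1 : 'rV[R]_m.+1) p.2.+1%:R^-1.
  pose F j := if @unpickle ('rV[rat]_m.+1 * nat)%type j is Some p then
    if `[< exists B, small_covers B (cell p) >] then cell p else set0 else set0.
  have s0 : exists B : R, small_covers B (set0 : set 'rV[R]_m.+1).
    exists 0 => K _ K0 d d0; exists [::]; split => //; last by rewrite big_nil.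
    by move=> x /K0.
  apply: (null F) => //.
  + move=> j; rewrite /F; case: unpickle => // p; case: ifP => // _.
    by apply: measurableI => //; exact: measurable_ball_rV.
  + move=> j; rewrite /F; case: unpickle => // p.
    by case: ifPn => // /asboolP.
  + move=> x Mx; have [rho [B [rho0 sB]]] := C1_hypersurface_local_covers hM Mx.
    have r20 : 0 < rho / 2 by rewrite divr_gt0.
    have [k _ /(_ k (leqnn _)) /= hk] := near_infty_natSinv_lt (PosNum r20).
    have k0 : 0 < k.+1%:R^-1 :> R by rewrite invr_gt0.
    have /fin_all_exists[q hq] : forall i : 'I_m.+1, exists q : rat,
        ball (x ord0 i) k.+1%:R^-1 (ratr q : R) by move=> i; exact: rat_near.
    have xq : ball x k.+1%:R^-1 (map_mx ratr (\row_i q i) : 'rV[R]_m.+1).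
      by split => // a i; rewrite (ord1 a) !mxE.
    exists (pickle (\row_i q i, k)) => //; rewrite /F pickleK ifT.
      by split => //; exact: ball_sym.
    apply/asboolP; exists B; apply: small_coversS sB => y [My qy]; split => //.
    apply: le_ball (ball_triangle xq qy); move: hk; rewrite /= => hk.
    by rewrite (splitr rho) lerD// ltW.
Qed.
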